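(* Let $n\ge 2$ be an integer. Consider, in the Newtonian planar $N$-body problem with $N=1+3n$, configurations of the following type: a central body of mass $m_0$ at the origin; a regular $n$-gon with vertices $\rho\, e^{2\pi i l/n}$, $l=0,\dots,n-1$ ($\rho>0$), each of mass $m_1$; and a regular $2n$-gon with vertices $e^{i\pi l/n}$, $l=0,\dots,2n-1$, whose masses are alternately $m_2$ (for even $l$) and $m_3$ (for odd $l$). (So the two polygons have the same symmetry axes.) For every $n\ge 237$ there exists a really perverse relative equilibrium of this type, and all the masses can be chosen to be positive. For $n\le 236$ no really perverse relative equilibrium of this type exists.
   Context: The Newtonian planar $N$-body problem (gravitational constant $1$): bodies with masses $\mu_i>0$ at positions $r_i\in\mathbb{C}$ satisfy $\mu_i\ddot r_i=\sum_{j\ne i}\mu_i\mu_j\,\frac{r_j-r_i}{|r_j-r_i|^3}$. A relative equilibrium (with angular velocity $1$) of a configuration $(r_1,\dots,r_N)$ is the motion $r_i(t)=r_i e^{it}$, when it is a solution. A mass system for the configuration type above is a vector $(m_0,m_1,m_2,m_3)$ of positive numbers, assigned as described; its total mass is $M=m_0+n(m_1+m_2+m_3)$ and its center of mass is then at the origin. The relative equilibrium $r_i(t)=r_ie^{it}$ is called really perverse if there exist two distinct mass systems with the same total mass and the same center of mass such that $r_i(t)=r_ie^{it}$ is a solution of the equations of motion for each of them. *)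

(* Defs.v *)
From Stdlib Require Import Reals Lra Lia List.
From Coquelicot Require Import Coquelicot.
Import ListNotations.
Open Scope R_scope.

(* Body indices: 0 = central body; 1..n = regular n-gon (l = k-1);
   n+1..3n = regular 2n-gon (l = k-n-1). Total N = 1 + 3n bodies. *)
Definition Nbodies (n : nat) : nat := (1 + 3 * n)%nat.

Definition pos (n : nat) (rho : R) (k : nat) : R * R :=
  if Nat.eqb k 0 then (0, 0)
  else if Nat.leb k n then
    let l := INR (k - 1) in
    (rho * cos (2 * PI * l / INR n), rho * sin (2 * PI * l / INR n))
  else
    let l := INR (k - n - 1) in
    (cos (PI * l / INR n), sin (PI * l / INR n)).

Definition mass_system := (R * R * R * R)%type.

Definition mass (n : nat) (m : mass_system) (k : nat) : R :=
  let '(m0, m1, m2, m3) := m in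
  if Nat.eqb k 0 then m0
  else if Nat.leb k n then m1
  else if Nat.even (k - n - 1) then m2 else m3.

Definition mass_positive (m : mass_system) : Prop :=
  let '(m0, m1, m2, m3) := m in 0 < m0 /\ 0 < m1 /\ 0 < m2 /\ 0 < m3.

Definition total_mass (n : nat) (m : mass_system) : R :=
  let '(m0, m1, m2, m3) := m in m0 + INR n * (m1 + m2 + m3).

Definition rotate (p : R * R) (t : R) : R * R :=
  (fst p * cos t - snd p * sin t, fst p * sin t + snd p * cos t).

Definition pdist (p q : R * R) : R :=
  sqrt ((fst q - fst p) ^ 2 + (snd q - snd p) ^ 2).

Definition sum_except (N i : nat) (f : nat -> R) : R :=
  fold_right Rplus 0 (map f (filter (fun j => negb (Nat.eqb j i)) (seq 0 N))).

Definition is_solution (N : nat) (mu : nat -> R) (q : nat -> R -> R * R) : Prop :=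
  forall i, (i < N)%nat -> forall t : R,
    (exists ax, is_derive_n (fun s => fst (q i s)) 2 t ax /\
       mu i * ax = sum_except N i (fun j =>
         mu i * mu j * (fst (q j t) - fst (q i t)) / (pdist (q i t) (q j t)) ^ 3)) /\
    (exists ay, is_derive_n (fun s => snd (q i s)) 2 t ay /\
       mu i * ay = sum_except N i (fun j =>
         mu i * mu j * (snd (q j t) - snd (q i t)) / (pdist (q i t) (q j t)) ^ 3)).

Definition RE_solution (n : nat) (rho : R) (m : mass_system) : Prop :=
  is_solution (Nbodies n) (mass n m) (fun i t => rotate (pos n rho i) t).

(* Admissible configuration of this type: rho > 0 and no collisions (rho <> 1). *)
Definition admissible (rho : R) : Prop := 0 < rho /\ rho <> 1.

(* Really perverse: two distinct (positive) mass systems with the same total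
   mass (center of mass is the origin for every mass system) for which the
   relative equilibrium is a solution. *)
Definition really_perverse (n : nat) (rho : R) : Prop :=
  exists m m' : mass_system,
    mass_positive m /\ mass_positive m' /\ m <> m' /\
    total_mass n m = total_mass n m' /\
    RE_solution n rho m /\ RE_solution n rho m'.

(* Main.v *)
Require Import Defs.
From Stdlib Require Import Reals Lra Lia ZArith List Machin Ranalysis5.
From Coquelicot Require Import Coquelicot.
Open Scope R_scope.

(** By symmetry a relative equilibrium amounts to three linear equations in the masses, one
    per ring, so two mass systems of equal total mass exist only if a 4 x 4 determinant
    vanishes. Let [a] and [a + b] be the attractions felt at a vertex of a regular [n]-gon
    and [2n]-gon of unit masses on the unit circle. Expanding [1 / |1 - rho e^(ix)|] and the
    Poisson kernel in cosines with nonnegative coefficients fixes the signs of the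
    interactions between the rings: if [a + b < 2n], every term of the determinant is
    negative. If [a + b > 2n] and [a <> n], the determinant changes sign between [rho = 0]
    and [rho = 1], and for [rho < 1] there are always positive masses, which can be moved
    slightly along the kernel. Finally the attraction of the regular [N]-gon is
    [1/4 sum_(0 < k < N) 1 / sin (PI k / N)]; divided by [N] it increases with [N], by
    convexity of [1 / sin], and it passes [1] between [N = 472] and [N = 473]. *)

(** * Finite sums *)

(** Every interaction is the sum of an even function over a regular [n]-gon, taken either at a
    vertex direction or half a step away. Averaging [cos (m x)] over the [n]-gon kills it unless [n]
    divides [m]; a surviving term changes at most its sign under the half step. Nonnegative
    coefficients therefore make the value at [0] dominate the absolute value half a step away,
    whatever [n] and [rho] are, so no attraction between the rings has to be estimated. Only
    [rho < 1] needs this analysis: replacing [rho] by [1 / rho] exchanges the roles of the two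
    radii, and the conditions on the determinant are symmetric under this exchange.

    The threshold for [n] comes from the [2n]-gon: [a + b < 2n] means that the attraction per vertex
    of a [2n]-gon is below [1], that is [2n <= 472]. As the ratio jumps over [1] between consecutive
    integers, it never equals [1], so neither [a + b = 2n] nor the excluded case [a = n] can
    occur. *)

Fixpoint rsum (f : nat -> R) (n : nat) : R :=
  match n with O => 0 | S m => rsum f m + f m end.

Lemma rsum_ext (f g : nat -> R) (n : nat) :
  (forall k, (k < n)%nat -> f k = g k) -> rsum f n = rsum g n.
Proof.
  induction n as [|n IH]; intros H; simpl; [reflexivity|].
  rewrite IH, H; auto.
Qed.

Lemma rsum_le (f g : nat -> R) (n : nat) :
  (forall k, (k < n)%nat -> f k <= g k) -> rsum f n <= rsum g n.
Proof.
  induction n as [|n IH]; intros H; simpl; [lra|].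
  apply Rplus_le_compat; auto.
Qed.

Lemma rsum_lin (a b : R) (f g : nat -> R) (n : nat) :
  rsum (fun k => a * f k + b * g k) n = a * rsum f n + b * rsum g n.
Proof. induction n as [|n IH]; simpl; [ring|rewrite IH; ring]. Qed.

Lemma rsum_scal (a : R) (f : nat -> R) (n : nat) :
  rsum (fun k => a * f k) n = a * rsum f n.
Proof. induction n as [|n IH]; simpl; [ring|rewrite IH; ring]. Qed.

Lemma rsum_opp (f : nat -> R) (n : nat) : rsum (fun k => - f k) n = - rsum f n.
Proof. induction n as [|n IH]; simpl; [ring|rewrite IH; ring]. Qed.

Lemma rsum_const (a : R) (n : nat) : rsum (fun _ => a) n = INR n * a.
Proof. induction n as [|n IH]; [simpl; ring|rewrite S_INR; simpl; rewrite IH; ring]. Qed.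

Lemma rsum_head (f : nat -> R) (n : nat) :
  rsum f (S n) = f 0%nat + rsum (fun k => f (S k)) n.
Proof. induction n as [|n IH]; simpl in *; [ring|rewrite IH; ring]. Qed.

Lemma rsum_rev (f : nat -> R) (n : nat) :
  rsum (fun k => f (n - 1 - k)%nat) n = rsum f n.
Proof.
  induction n as [|n IH]; [reflexivity|].
  rewrite rsum_head. simpl (rsum f (S n)). rewrite <- IH.
  replace (S n - 1 - 0)%nat with n by lia.
  rewrite Rplus_comm. f_equal. apply rsum_ext. intros k Hk. f_equal. lia.
Qed.

Lemma rsum_add (f : nat -> R) (n m : nat) :
  rsum f (n + m) = rsum f n + rsum (fun k => f (n + k)%nat) m.
Proof.
  induction m as [|m IH]; [rewrite Nat.add_0_r; simpl; ring|].
  rewrite Nat.add_succ_r; simpl. rewrite IH; ring.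
Qed.

Lemma rsum_even_odd (f : nat -> R) (n : nat) :
  rsum f (2 * n) = rsum (fun k => f (2 * k)%nat) n + rsum (fun k => f (2 * k + 1)%nat) n.
Proof.
  induction n as [|n IH]; [simpl; ring|].
  replace (2 * S n)%nat with (S (S (2 * n))) by lia.
  cbn [rsum]. rewrite IH. replace (2 * n + 1)%nat with (S (2 * n)) by lia. ring.
Qed.

Lemma is_lim_seq_rsum (u : nat -> nat -> R) (l : nat -> R) (n : nat) :
  (forall k, is_lim_seq (fun j => u j k) (l k)) ->
  is_lim_seq (fun j => rsum (u j) n) (rsum l n).
Proof.
  intros H. induction n as [|n IH]; simpl; [apply is_lim_seq_const|].
  apply (is_lim_seq_plus' _ _ _ _ IH (H n)).
Qed.

Lemma continuity_pt_rsum (f : nat -> R -> R) (n : nat) (x : R) :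
  (forall k, (k < n)%nat -> continuity_pt (f k) x) ->
  continuity_pt (fun y => rsum (fun k => f k y) n) x.
Proof.
  induction n as [|n IH]; intros H; simpl.
  - apply continuity_pt_const. intros ? ?; reflexivity.
  - apply (continuity_pt_plus (fun y => rsum (fun k => f k y) n) (f n)); auto.
Qed.

(** * Cosecant sums *)

Lemma sin_le_tangent (x m : R) : 0 <= x <= PI -> 0 <= m <= PI ->
  sin x <= sin m + cos m * (x - m).
Proof.
  intros Hx Hm. destruct (Rtotal_order x m) as [H|[H|H]].
  - destruct (MVT_cor2 sin cos x m H) as [c [Hc1 Hc2]].
    { intros c _. apply derivable_pt_lim_sin. }
    assert (cos m <= cos c) by (apply cos_decr_1; lra). nra.
  - subst. lra.
  - destruct (MVT_cor2 sin cos m x H) as [c [Hc1 Hc2]].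
    { intros c _. apply derivable_pt_lim_sin. }
    assert (cos c <= cos m) by (apply cos_decr_1; lra). nra.
Qed.

(** Concavity of the sine, followed by the decreasing convex function [1 / s]. *)
Lemma inv_sin_convex (l x y : R) : 0 <= l <= 1 -> 0 < x < PI -> 0 < y < PI ->
  / sin (l * x + (1 - l) * y) <= l * / sin x + (1 - l) * / sin y.
Proof.
  intros Hl Hx Hy. set (m := l * x + (1 - l) * y).
  assert (Hm : 0 < m < PI) by (unfold m; destruct (Rle_dec x y); split; nra).
  assert (Sx := sin_gt_0 x (proj1 Hx) (proj2 Hx)).
  assert (Sy := sin_gt_0 y (proj1 Hy) (proj2 Hy)).
  assert (Sm := sin_gt_0 m (proj1 Hm) (proj2 Hm)).
  assert (H1 := sin_le_tangent x m ltac:(lra) ltac:(lra)).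
  assert (H2 := sin_le_tangent y m ltac:(lra) ltac:(lra)).
  assert (H3 : l * sin x + (1 - l) * sin y <= sin m).
  { apply (Rmult_le_compat_l l) in H1; [|lra].
    apply (Rmult_le_compat_l (1 - l)) in H2; [|lra].
    assert (cos m * (l * (x - m) + (1 - l) * (y - m)) = 0) by (unfold m; ring). lra. }
  set (s := sin x) in *. set (t := sin y) in *. set (w := l * s + (1 - l) * t) in *.
  assert (Hw : 0 < w).
  { unfold w. destruct (Rle_or_lt s t).
    - assert (0 <= (1 - l) * (t - s)) by (apply Rmult_le_pos; lra). lra.
    - assert (0 <= l * (s - t)) by (apply Rmult_le_pos; lra). lra. }
  apply Rle_trans with (/ w); [apply Rinv_le_contravar; assumption|].
  apply Rmult_le_reg_r with (w * (s * t)); [repeat apply Rmult_lt_0_compat; assumption|].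
  replace (/ w * (w * (s * t))) with (s * t) by (field; lra).
  replace ((l * / s + (1 - l) * / t) * (w * (s * t)))
    with ((l * t + (1 - l) * s) * w) by (field; lra).
  (* The gap in the weighted inequality between harmonic and arithmetic means, after clearing
     denominators. *)
  assert (0 <= l * (1 - l) * (s - t) ^ 2) 
    by (apply Rmult_le_pos; [apply Rmult_le_pos; lra|apply pow2_ge_0]).
  unfold w. lra.
Qed.

(* The term [k = 0] contributes [/ 0 = 0]. *)
Definition csc (N : nat) (k : nat) : R := / sin (PI * INR k / INR N).

Definition csc_sum (N : nat) : R := rsum (csc N) N.

Lemma csc_0 (N : nat) : csc N 0 = 0.
Proof.
  unfold csc. simpl. replace (PI * 0 / INR N) with 0 by (unfold Rdiv; ring).
  rewrite sin_0. apply Rinv_0.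
Qed.

Lemma arc_bounds (N k : nat) : (0 < k < N)%nat -> 0 < PI * INR k / INR N < PI.
Proof.
  intros Hk. assert (HP := PI_RGT_0).
  assert (0 < INR k) by (apply lt_0_INR; lia).
  assert (INR k < INR N) by (apply lt_INR; lia).
  split.
  - apply Rdiv_lt_0_compat; nra.
  - apply Rmult_lt_reg_r with (INR N); [lra|].
    replace (PI * INR k / INR N * INR N) with (PI * INR k) by (field; lra). nra.
Qed.

Lemma csc_pos (N k : nat) : (0 < k < N)%nat -> 0 < csc N k.
Proof.
  intros Hk. destruct (arc_bounds N k Hk).
  apply Rinv_0_lt_compat, sin_gt_0; assumption.
Qed.

Lemma csc_sum_nonneg (N : nat) : 0 <= csc_sum N.
Proof.
  unfold csc_sum. replace 0 with (rsum (fun _ => 0) N) by (rewrite rsum_const; ring).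
  apply rsum_le. intros k Hk. destruct k; [rewrite csc_0; lra|].
  apply Rlt_le, csc_pos; lia.
Qed.

(* The point [l/N] divides the segment from [l/(N+1)] to [(l+1)/(N+1)] in the ratio
   [l : N-l]. *)
Lemma csc_interpolation (N l : nat) : (l < N)%nat ->
  INR N * csc N l <= (INR N - INR l) * csc (S N) l + INR l * csc (S N) (S l).
Proof.
  intros Hl. destruct l as [|l].
  { rewrite !csc_0. simpl. lra. }
  set (k := S l) in *.
  assert (Hk : 0 < INR k) by (apply lt_0_INR; unfold k; lia).
  assert (HkN : INR k < INR N) by (apply lt_INR; assumption).
  assert (H := inv_sin_convex ((INR N - INR k) / INR N)
    (PI * INR k / INR (S N)) (PI * INR (S k) / INR (S N))).
  assert (Hd : 0 <= (INR N - INR k) / INR N <= 1).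
  { split; [apply Rdiv_le_0_compat; lra|].
    apply Rmult_le_reg_r with (INR N); [lra|].
    replace ((INR N - INR k) / INR N * INR N) with (INR N - INR k) by (field; lra). lra. }
  specialize (H Hd (arc_bounds (S N) k ltac:(unfold k; lia))
    (arc_bounds (S N) (S k) ltac:(lia))).
  replace ((INR N - INR k) / INR N * (PI * INR k / INR (S N)) +
       (1 - (INR N - INR k) / INR N) * (PI * INR (S k) / INR (S N)))
    with (PI * INR k / INR N) in H by (rewrite !S_INR; field; lra).
  unfold csc.
  apply (Rmult_le_compat_l (INR N)) in H; [|lra].
  eapply Rle_trans; [exact H|]. apply Req_le. field.
  repeat split; try lra; apply Rgt_not_eq, sin_gt_0;
    apply arc_bounds; unfold k; lia.
Qed.

Lemma csc_sum_succ (N : nat) :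
  csc_sum N * INR (S N) <= csc_sum (S N) * INR N.
Proof.
  destruct N as [|M].
  { unfold csc_sum. simpl. rewrite csc_0. lra. }
  set (N := S M).
  assert (HN : 1 <= INR N) by (unfold N; rewrite S_INR; pose proof (pos_INR M); lra).
  (* An interior value [g j] collects [N - j] from its own term and [j - 1] from the preceding one,
     hence [N - 1] in all. *)
  assert (Hsum : forall g K, g 0%nat = 0 ->
    rsum (fun l => (INR N - INR l) * g l + INR l * g (S l)) K
    = (INR N - 1) * rsum g K + (INR K - 1) * g K).
  { intros g K Hg. induction K as [|K IH]; [simpl; rewrite Hg; ring|].
    rewrite S_INR. cbn [rsum]. rewrite IH. ring. }
  assert (H : INR N * csc_sum N <= (INR N - 1) * csc_sum (S N)).
  { unfold csc_sum at 1. rewrite <- rsum_scal.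
    eapply Rle_trans; [apply rsum_le; intros; apply csc_interpolation; assumption|].
    rewrite Hsum by apply csc_0. unfold csc_sum. cbn [rsum]. lra. }
  (* Nonnegativity absorbs the gap between [(N - 1) (N + 1)] and [N ^ 2]. *)
  assert (H0 := csc_sum_nonneg (S N)).
  rewrite S_INR. apply Rmult_le_reg_l with (INR N); [lra|].
  apply (Rmult_le_compat_r (INR N + 1)) in H; lra.
Qed.

Lemma csc_sum_mono (N M : nat) : (1 <= N)%nat -> (N <= M)%nat ->
  csc_sum N * INR M <= csc_sum M * INR N.
Proof.
  intros HN HM. induction HM as [|M HM IH]; [lra|].
  assert (H := csc_sum_succ M).
  assert (0 < INR N) by (apply lt_0_INR; lia).
  assert (0 < INR M) by (apply lt_0_INR; lia).
  assert (0 < INR (S M)) by (apply lt_0_INR; lia).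
  apply Rmult_le_reg_r with (INR M); [assumption|].
  apply (Rmult_le_compat_r (INR (S M))) in IH; [|lra].
  apply (Rmult_le_compat_r (INR N)) in H; [|lra]. lra.
Qed.

(** Each even point is the midpoint of its odd neighbours, so convexity charges it half of either
    neighbour. Half of the first and half of the last odd term remain, which makes the inequality
    strict. This yields [a < b]. *)
Lemma csc_even_lt_odd (n : nat) : (1 <= n)%nat ->
  rsum (fun l => csc (2 * n) (2 * l)) n < rsum (fun l => csc (2 * n) (2 * l + 1)) n.
Proof.
  intros Hn. set (g := csc (2 * n)).
  assert (H : forall K, (S K <= n)%nat ->
    (g 1%nat + g (2 * K + 1)%nat) / 2 <=
    rsum (fun l => g (2 * l + 1)%nat) (S K) - rsum (fun l => g (2 * l)%nat) (S K)).
  { induction K as [|K IH]; intros HK.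
    - simpl. unfold g at 4. rewrite csc_0. lra.
    - specialize (IH ltac:(lia)).
      remember (S K) as L eqn:HL. cbn [rsum].
      assert (HL0 : (0 < L)%nat) by lia.
      assert (g (2 * L)%nat <= (g (2 * K + 1)%nat + g (2 * L + 1)%nat) / 2).
      { assert (HC := inv_sin_convex (1/2) (PI * INR (2 * K + 1) / INR (2 * n))
          (PI * INR (2 * L + 1) / INR (2 * n)) ltac:(lra)
          (arc_bounds (2 * n) (2 * K + 1) ltac:(lia))
          (arc_bounds (2 * n) (2 * L + 1) ltac:(lia))).
        unfold g, csc.
        replace (PI * INR (2 * L) / INR (2 * n)) with
          (1 / 2 * (PI * INR (2 * K + 1) / INR (2 * n)) +
            (1 - 1 / 2) * (PI * INR (2 * L + 1) / INR (2 * n))); [lra|].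
        subst L. rewrite !plus_INR, !mult_INR, !S_INR. simpl (INR 0).
        assert (INR n <> 0) by (apply not_0_INR; lia). field. lra. }
      lra. }
  specialize (H (n - 1)%nat ltac:(lia)).
  replace (S (n - 1))%nat with n in H by lia.
  assert (0 < g 1%nat) by (apply csc_pos; lia).
  assert (0 < g (2 * (n - 1) + 1)%nat) by (apply csc_pos; lia).
  lra.
Qed.

(** * Numerical bounds at the threshold *)

Lemma PI_approx : 3.14159 < PI < 3.1416.
Proof.
  destruct (PI_2_3_7_ineq 3) as [H1 H2].
  unfold tg_alt, PI_2_3_7_tg, Ratan_seq in *. simpl in *. split; lra.
Qed.

Lemma csc_sym (N k : nat) : (0 < k < N)%nat -> csc N (N - k) = csc N k.
Proof.
  intros Hk. unfold csc. f_equal. rewrite minus_INR by lia.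
  rewrite <- sin_PI_x. f_equal. field. apply not_0_INR. lia.
Qed.

Definition zsum (c : nat -> Z) (n : nat) : Z :=
  fold_right Z.add 0%Z (map c (seq 0 n)).

Lemma IZR_zsum (c : nat -> Z) (n : nat) : IZR (zsum c n) = rsum (fun k => IZR (c k)) n.
Proof.
  unfold zsum. induction n as [|n IH]; [reflexivity|].
  rewrite seq_S, map_app, fold_right_app. cbn [rsum]. rewrite <- IH. simpl.
  generalize (seq 0 n). intros l. induction l as [|x l IHl]; simpl.
  - rewrite plus_IZR. ring.
  - rewrite !plus_IZR, IHl. ring.
Qed.

(* Integers bracketing [10^7 / sin (PI k / N)], from the Taylor polynomials of degree 7
   and 9 at [314159 k / (100000 N)] and [31416 k / (10000 N)]. *)
Definition csc_upper (N k : Z) : Z :=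
  let X := (314159 * k)%Z in let D := (100000 * N)%Z in
  ((10 ^ 7 * (5040 * D ^ 7)) /
   (X * (5040 * D ^ 6 - 840 * X ^ 2 * D ^ 4 + 42 * X ^ 4 * D ^ 2 - X ^ 6)) + 1)%Z.

Definition csc_lower (N k : Z) : Z :=
  let X := (31416 * k)%Z in let D := (10000 * N)%Z in
  ((10 ^ 7 * (362880 * D ^ 9)) /
   (X * (362880 * D ^ 8 - 60480 * X ^ 2 * D ^ 6 + 3024 * X ^ 4 * D ^ 4
         - 72 * X ^ 6 * D ^ 2 + X ^ 8)))%Z.

Lemma INR_odd_facts : INR (fact 1) = 1 /\ INR (fact 3) = 6 /\ INR (fact 5) = 120 /\
  INR (fact 7) = 5040 /\ INR (fact 9) = 362880.
Proof.
  assert (E : forall k, INR (fact (S k)) = INR (S k) * INR (fact k))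
    by (intros k; rewrite fact_simpl; apply mult_INR).
  rewrite !E. simpl INR. repeat split; lra.
Qed.

Lemma sin_taylor (x : R) : 0 <= x <= PI ->
  x * (5040 - 840 * x ^ 2 + 42 * x ^ 4 - x ^ 6) / 5040 <= sin x <=
  x * (362880 - 60480 * x ^ 2 + 3024 * x ^ 4 - 72 * x ^ 6 + x ^ 8) / 362880.
Proof.
  intros Hx. destruct (SIN x) as [H1 H2]; [lra..|].
  destruct INR_odd_facts as (F1 & F3 & F5 & F7 & F9).
  unfold sin_lb, sin_ub, sin_approx, sin_term in H1, H2. cbn [sum_f_R0] in H1, H2.
  change (2 * 0 + 1)%nat with 1%nat in H1, H2. change (2 * 1 + 1)%nat with 3%nat in H1, H2.
  change (2 * 2 + 1)%nat with 5%nat in H1, H2. change (2 * 3 + 1)%nat with 7%nat in H1, H2.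
  change (2 * 4 + 1)%nat with 9%nat in H2.
  rewrite F1, F3, F5, F7 in H1. rewrite F1, F3, F5, F7, F9 in H2. split; lra.
Qed.

Lemma IZR_div_le (a b : Z) : (0 < b)%Z -> IZR (a / b) <= IZR a / IZR b <= IZR (a / b + 1).
Proof.
  intros Hb. assert (0 < IZR b) by (apply (IZR_lt 0); assumption).
  assert (H1 := Z.mul_div_le a b Hb). assert (H2 := Z.mul_succ_div_gt a b Hb).
  apply IZR_le in H1. apply IZR_lt in H2. rewrite mult_IZR in H1, H2.
  split; apply Rmult_le_reg_r with (IZR b); try assumption;
    replace (IZR a / IZR b * IZR b) with (IZR a) by (field; lra);
    unfold Z.succ in H2; lra.
Qed.

(** Up to a right angle the sine increases, so a rational angle slightly below [PI k / N] gives a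
    smaller sine and a larger cosecant. *)
Lemma csc_upper_spec (N k : nat) : (0 < k)%nat -> (2 * k <= N)%nat ->
  csc N k <= IZR (csc_upper (Z.of_nat N) (Z.of_nat k)) / 10 ^ 7.
Proof.
  intros Hk HN.
  assert (K0 : 0 < INR k) by (apply lt_0_INR; lia).
  assert (K1 : 2 * INR k <= INR N) by (apply le_INR in HN; rewrite mult_INR in HN; exact HN).
  destruct PI_approx as [P1 P2].
  set (x := 314159 * INR k / (100000 * INR N)).
  assert (X0 : 0 < x) by (apply Rdiv_lt_0_compat; lra).
  assert (X1 : x <= 3.14159 / 2).
  { unfold x. apply Rmult_le_reg_r with (100000 * INR N); [lra|].
    replace (314159 * INR k / (100000 * INR N) * (100000 * INR N)) with (314159 * INR k)
      by (field; lra). lra. }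
  assert (X2 : x <= PI * INR k / INR N).
  { unfold x. apply Rmult_le_reg_r with (INR N); [lra|].
    replace (314159 * INR k / (100000 * INR N) * INR N) with (314159 / 100000 * INR k) by (field; lra).
    replace (PI * INR k / INR N * INR N) with (PI * INR k) by (field; lra). nra. }
  assert (X3 : PI * INR k / INR N <= PI / 2).
  { apply Rmult_le_reg_r with (INR N); [lra|].
    replace (PI * INR k / INR N * INR N) with (PI * INR k) by (field; lra). nra. }
  set (p := 5040 - 840 * x ^ 2 + 42 * x ^ 4 - x ^ 6).
  assert (Hp : 0 < p).
  { unfold p. assert (0 <= x ^ 2 <= 2.5) by (split; nra).
    replace (x ^ 4) with ((x ^ 2) ^ 2) by ring. replace (x ^ 6) with ((x ^ 2) ^ 3) by ring.
    set (u := x ^ 2) in *. nra. }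
  assert (Hs : x * p / 5040 <= sin (PI * INR k / INR N)).
  { eapply Rle_trans; [apply sin_taylor; lra|]. apply sin_incr_1; lra. }
  unfold csc. apply Rle_trans with (/ (x * p / 5040)).
  { apply Rinv_le_contravar; [|assumption]. apply Rdiv_lt_0_compat; [nra|lra]. }
  unfold csc_upper.
  set (X := (314159 * Z.of_nat k)%Z). set (D := (100000 * Z.of_nat N)%Z).
  set (num := (X * (5040 * D ^ 6 - 840 * X ^ 2 * D ^ 4 + 42 * X ^ 4 * D ^ 2 - X ^ 6))%Z).
  assert (HX : IZR X = 314159 * INR k) by (unfold X; rewrite mult_IZR, <- INR_IZR_INZ; reflexivity).
  assert (HD : IZR D = 100000 * INR N) by (unfold D; rewrite mult_IZR, <- INR_IZR_INZ; reflexivity).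
  assert (D0 : 0 < IZR D) by lra.
  assert (Hx : x = IZR X / IZR D) by (unfold x; rewrite HX, HD; reflexivity).
  assert (Hnum : IZR num = x * p * IZR D ^ 7).
  { unfold num, p. rewrite Hx. rewrite mult_IZR, minus_IZR, plus_IZR, minus_IZR, !mult_IZR.
    change 6%Z with (Z.of_nat 6). change 4%Z with (Z.of_nat 4). change 2%Z with (Z.of_nat 2).
    rewrite <- !pow_IZR. field. lra. }
  assert (N0 : 0 < IZR num).
  { rewrite Hnum. apply Rmult_lt_0_compat; [nra|apply pow_lt; lra]. }
  destruct (IZR_div_le (10 ^ 7 * (5040 * D ^ 7)) num) as [_ H]; [apply lt_IZR; exact N0|].
  apply Rmult_le_reg_r with (10 ^ 7); [lra|].
  unfold Rdiv at 2. rewrite Rmult_assoc, Rinv_l, Rmult_1_r by lra.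
  eapply Rle_trans; [|exact H]. apply Req_le.
  rewrite Hnum, !mult_IZR. change 7%Z with (Z.of_nat 7). rewrite <- !pow_IZR.
  field. repeat split; try lra. 
Qed.

(** The rational angle now lies above [PI k / N] and must itself stay below [PI / 2]; the integer
    hypothesis bounds it by [1.57]. This excludes [k = N / 2], which does no harm for the odd number
    [473]. *)
Lemma csc_lower_spec (N k : nat) : (0 < k < N)%nat ->
  (31416 * Z.of_nat k <= 15700 * Z.of_nat N)%Z ->
  IZR (csc_lower (Z.of_nat N) (Z.of_nat k)) / 10 ^ 7 <= csc N k.
Proof.
  intros Hk HN.
  assert (K0 : 0 < INR k) by (apply lt_0_INR; lia).
  assert (K1 : INR k < INR N) by (apply lt_INR; lia).
  assert (K2 : 31416 * INR k <= 15700 * INR N).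
  { apply IZR_le in HN. rewrite !mult_IZR, <- !INR_IZR_INZ in HN. exact HN. }
  destruct PI_approx as [P1 P2].
  set (x := 31416 * INR k / (10000 * INR N)).
  assert (X0 : 0 < x) by (apply Rdiv_lt_0_compat; lra).
  assert (X1 : x <= 1.57).
  { unfold x. apply Rmult_le_reg_r with (10000 * INR N); [lra|].
    replace (31416 * INR k / (10000 * INR N) * (10000 * INR N)) with (31416 * INR k)
      by (field; lra). lra. }
  assert (X2 : PI * INR k / INR N <= x).
  { unfold x. apply Rmult_le_reg_r with (INR N); [lra|].
    replace (31416 * INR k / (10000 * INR N) * INR N) with (31416 / 10000 * INR k) by (field; lra).
    replace (PI * INR k / INR N * INR N) with (PI * INR k) by (field; lra). nra. }
  assert (X3 : 0 < PI * INR k / INR N < PI) by (apply arc_bounds; lia).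
  set (p := 362880 - 60480 * x ^ 2 + 3024 * x ^ 4 - 72 * x ^ 6 + x ^ 8).
  assert (S0 : 0 < sin (PI * INR k / INR N)) by (apply sin_gt_0; lra).
  assert (Hs : sin (PI * INR k / INR N) <= x * p / 362880).
  { eapply Rle_trans; [|apply sin_taylor; lra]. apply sin_incr_1; lra. }
  assert (Hp : 0 < p) by nra.
  unfold csc. apply Rle_trans with (/ (x * p / 362880));
    [|apply Rinv_le_contravar; assumption].
  unfold csc_lower.
  set (X := (31416 * Z.of_nat k)%Z). set (D := (10000 * Z.of_nat N)%Z).
  set (num := (X * (362880 * D ^ 8 - 60480 * X ^ 2 * D ^ 6 + 3024 * X ^ 4 * D ^ 4
         - 72 * X ^ 6 * D ^ 2 + X ^ 8))%Z).
  assert (HX : IZR X = 31416 * INR k) by (unfold X; rewrite mult_IZR, <- INR_IZR_INZ; reflexivity).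
  assert (HD : IZR D = 10000 * INR N) by (unfold D; rewrite mult_IZR, <- INR_IZR_INZ; reflexivity).
  assert (D0 : 0 < IZR D) by lra.
  assert (Hx : x = IZR X / IZR D) by (unfold x; rewrite HX, HD; reflexivity).
  assert (Hnum : IZR num = x * p * IZR D ^ 9).
  { unfold num, p. rewrite Hx.
    rewrite mult_IZR, plus_IZR, minus_IZR, plus_IZR, minus_IZR, !mult_IZR.
    change 8%Z with (Z.of_nat 8). change 6%Z with (Z.of_nat 6).
    change 4%Z with (Z.of_nat 4). change 2%Z with (Z.of_nat 2).
    rewrite <- !pow_IZR. field. lra. }
  assert (N0 : 0 < IZR num).
  { rewrite Hnum. apply Rmult_lt_0_compat; [nra|apply pow_lt; lra]. }
  destruct (IZR_div_le (10 ^ 7 * (362880 * D ^ 9)) num) as [H _]; [apply lt_IZR; exact N0|].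
  apply Rmult_le_reg_r with (10 ^ 7); [lra|].
  unfold Rdiv at 1. rewrite Rmult_assoc, Rinv_l, Rmult_1_r by lra.
  eapply Rle_trans; [exact H|]. apply Req_le.
  rewrite Hnum, !mult_IZR. change 9%Z with (Z.of_nat 9). change 7%Z with (Z.of_nat 7).
  rewrite <- !pow_IZR. field. repeat split; lra.
Qed.

(** Folding [k] onto [min (k, 472 - k)] keeps the angle within the range of [csc_upper]; what
    remains is integer arithmetic. *)
Lemma csc_sum_472 : csc_sum 472 < 4 * 472.
Proof.
  set (c := fun k => if Nat.eqb k 0 then 0%Z
                     else csc_upper 472 (Z.of_nat (Nat.min k (472 - k)))).
  apply Rle_lt_trans with (/ 10 ^ 7 * IZR (zsum c 472)).
  - rewrite IZR_zsum, <- rsum_scal. apply rsum_le. intros k Hk. unfold c.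
    destruct (Nat.eqb_spec k 0) as [->|Hk0]; [rewrite csc_0; lra|].
    rewrite Rmult_comm.
    destruct (Nat.min_spec k (472 - k)) as [[Hm ->]|[Hm ->]].
    + apply (csc_upper_spec 472); lia.
    + rewrite <- (csc_sym 472 k) by lia. apply (csc_upper_spec 472); lia.
  - assert (H : (zsum c 472 < 10 ^ 7 * (4 * 472))%Z) by (vm_compute; reflexivity).
    apply IZR_lt in H. rewrite !mult_IZR in H. change (IZR (10 ^ 7)) with 10000000 in H. lra.
Qed.

Lemma csc_sum_473 : 4 * 473 < csc_sum 473.
Proof.
  set (c := fun k => if Nat.eqb k 0 then 0%Z
                     else csc_lower 473 (Z.of_nat (Nat.min k (473 - k)))).
  apply Rlt_le_trans with (/ 10 ^ 7 * IZR (zsum c 473)).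
  - assert (H : (10 ^ 7 * (4 * 473) < zsum c 473)%Z) by (vm_compute; reflexivity).
    apply IZR_lt in H. rewrite !mult_IZR in H. change (IZR (10 ^ 7)) with 10000000 in H. lra.
  - rewrite IZR_zsum, <- rsum_scal. apply rsum_le. intros k Hk. unfold c.
    destruct (Nat.eqb_spec k 0) as [->|Hk0]; [rewrite csc_0; lra|].
    rewrite Rmult_comm.
    destruct (Nat.min_spec k (473 - k)) as [[Hm ->]|[Hm ->]].
    + apply (csc_lower_spec 473); lia.
    + rewrite <- (csc_sym 473 k) by lia. apply (csc_lower_spec 473); lia.
Qed.

Lemma csc_sum_small (N : nat) : (1 <= N <= 472)%nat -> csc_sum N < 4 * INR N.
Proof.
  intros HN. assert (H := csc_sum_mono N 472 ltac:(lia) ltac:(lia)).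
  assert (0 < INR N) by (apply lt_0_INR; lia).
  assert (H' := csc_sum_472). replace (INR 472) with 472 in H by (simpl; lra). nra.
Qed.

Lemma csc_sum_large (N : nat) : (473 <= N)%nat -> 4 * INR N < csc_sum N.
Proof.
  intros HN. assert (H := csc_sum_mono 473 N ltac:(lia) ltac:(lia)).
  assert (0 < INR N) by (apply lt_0_INR; lia).
  assert (H' := csc_sum_473). replace (INR 473) with 473 in H by (simpl; lra). nra.
Qed.

(** * Sums over regular polygons *)

(** Only [theta = 0] and [theta = PI / n], up to sign and rotation, occur for bodies off the origin:
    they lie on symmetry axes of every [n]-gon, through a vertex or between two vertices. *)
Definition gon (n : nat) (f : R -> R) (theta : R) : R :=
  rsum (fun l => f (theta + 2 * PI * INR l / INR n)) n.

Definition periodic (f : R -> R) : Prop := forall x, f (x + 2 * PI) = f x.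

Lemma gon_ext (n : nat) (f g : R -> R) (theta : R) :
  (forall x, f x = g x) -> gon n f theta = gon n g theta.
Proof. intros H. apply rsum_ext. auto. Qed.

Lemma gon_lin (n : nat) (a b : R) (f g : R -> R) (theta : R) :
  gon n (fun x => a * f x + b * g x) theta = a * gon n f theta + b * gon n g theta.
Proof. apply rsum_lin. Qed.

Lemma gon_step (n : nat) (f : R -> R) (theta : R) : (1 <= n)%nat -> periodic f ->
  gon n f (theta + 2 * PI / INR n) = gon n f theta.
Proof.
  intros Hn Hf. unfold gon. destruct n as [|m]; [lia|]. set (n := S m).
  assert (Hn0 : INR n <> 0) by (apply not_0_INR; unfold n; lia).
  assert (E : rsum (fun l => f (theta + 2 * PI * INR l / INR n)) (S n) =
    rsum (fun l => f (theta + 2 * PI * INR l / INR n)) n + f theta).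
  { cbn [rsum]. f_equal. rewrite <- (Hf theta). f_equal. field. assumption. }
  rewrite rsum_head in E.
  replace (theta + 2 * PI * INR 0 / INR n) with theta in E by (simpl; field; assumption).
  rewrite Rplus_comm in E. apply Rplus_eq_reg_r in E. rewrite <- E.
  apply rsum_ext. intros k _. f_equal. rewrite S_INR. field. assumption.
Qed.

Lemma gon_shift (n k : nat) (f : R -> R) (theta : R) : (1 <= n)%nat -> periodic f ->
  gon n f (theta - 2 * PI * INR k / INR n) = gon n f theta.
Proof.
  intros Hn Hf. assert (Hn0 : INR n <> 0) by (apply not_0_INR; lia).
  induction k as [|k IH].
  - f_equal. simpl. field. assumption.
  - rewrite <- gon_step by assumption. rewrite <- IH. f_equal. rewrite S_INR. field. assumption.
Qed.

Lemma gon_reflect (n : nat) (f : R -> R) (theta : R) : (1 <= n)%nat -> periodic f ->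
  gon n f theta = gon n (fun x => f (- x)) (- theta).
Proof.
  intros Hn Hf. assert (Hn0 : INR n <> 0) by (apply not_0_INR; lia).
  rewrite <- (gon_step n (fun x => f (- x))); [|assumption|].
  - unfold gon. rewrite <- rsum_rev. apply rsum_ext. intros k Hk.
    rewrite <- (Hf (- _)). f_equal.
    rewrite !minus_INR by lia. simpl. field. assumption.
  - intros x. rewrite <- (Hf (- (x + 2 * PI))). f_equal. ring.
Qed.

Lemma gon_half_even (n : nat) (f : R -> R) : (1 <= n)%nat -> periodic f ->
  (forall x, f (- x) = f x) -> gon n f (- (PI / INR n)) = gon n f (PI / INR n).
Proof.
  intros Hn Hf He. rewrite gon_reflect by assumption. rewrite Ropp_involutive.
  apply gon_ext. exact He.
Qed.

(** Reflection fixes the direction [0], and it fixes [PI / n] up to one step of the polygon, so the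
    terms cancel in pairs. *)
Lemma gon_odd (n : nat) (f : R -> R) : (1 <= n)%nat -> periodic f ->
  (forall x, f (- x) = - f x) ->
  gon n f 0 = 0 /\ gon n f (PI / INR n) = 0 /\ gon n f (- (PI / INR n)) = 0.
Proof.
  intros Hn Hf Ho. assert (Hn0 : INR n <> 0) by (apply not_0_INR; lia).
  assert (H : forall theta, gon n f theta = - gon n f (- theta)).
  { intros theta. rewrite gon_reflect by assumption.
    rewrite (gon_ext _ _ (fun x => (-1) * f x + 0 * f x)) by (intros; rewrite Ho; ring).
    rewrite gon_lin. ring. }
  assert (H0 := H 0). rewrite Ropp_0 in H0.
  assert (H1 := H (PI / INR n)).
  assert (H2 := gon_step n f (- (PI / INR n)) Hn Hf).
  replace (- (PI / INR n) + 2 * PI / INR n) with (PI / INR n) in H2 by (field; assumption).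
  repeat split; lra.
Qed.

Lemma rsum_cos_progression (beta alpha : R) (n : nat) :
  2 * sin (alpha / 2) * rsum (fun l => cos (beta + INR l * alpha)) n =
  sin (beta + INR n * alpha - alpha / 2) - sin (beta - alpha / 2).
Proof.
  induction n as [|n IH].
  - simpl. replace (beta + 0 * alpha - alpha / 2) with (beta - alpha / 2) by ring. ring.
  - cbn [rsum]. rewrite Rmult_plus_distr_l, IH, S_INR.
    replace (beta + (INR n + 1) * alpha - alpha / 2)
      with (beta + INR n * alpha + alpha / 2) by field.
    set (u := beta + INR n * alpha). rewrite (sin_plus u), (sin_minus u). ring.
Qed.

Lemma periodic_nat (f : R -> R) (k : nat) (x : R) : periodic f -> f (x + 2 * PI * INR k) = f x.
Proof.
  intros Hf. induction k as [|k IH].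
  - f_equal. simpl. ring.
  - rewrite <- IH, <- (Hf (x + 2 * PI * INR k)). f_equal. rewrite S_INR. ring.
Qed.

Lemma periodic_sin : periodic sin.
Proof. intros x. rewrite <- (sin_period x 1). f_equal. simpl. ring. Qed.

Lemma periodic_cos : periodic cos.
Proof. intros x. rewrite <- (cos_period x 1). f_equal. simpl. ring. Qed.

(* Orthogonality of characters of [Z/n]. *)
Lemma gon_cos (n m : nat) : (1 <= n)%nat ->
  (forall theta, gon n (fun x => cos (INR m * x)) theta = 0) \/
  (forall theta, gon n (fun x => cos (INR m * x)) theta = INR n * cos (INR m * theta)).
Proof.
  intros Hn. assert (Hn0 : INR n <> 0) by (apply not_0_INR; lia).
  set (alpha := 2 * PI * INR m / INR n).
  assert (E : forall theta, gon n (fun x => cos (INR m * x)) theta =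
     rsum (fun l => cos (INR m * theta + INR l * alpha)) n).
  { intros theta. apply rsum_ext. intros l _. f_equal. unfold alpha. field. assumption. }
  (* As [alpha / 2 = PI m / n], this vanishing expresses that [n] divides [m]. *)
  destruct (Req_dec (sin (alpha / 2)) 0) as [Hs|Hs].
  - right. intros theta. rewrite E.
    assert (Hc : cos alpha = 1).
    { replace alpha with (2 * (alpha / 2)) by field. rewrite cos_2a_sin, Hs. ring. }
    assert (Hs' : sin alpha = 0).
    { replace alpha with (2 * (alpha / 2)) by field. rewrite sin_2a, Hs. ring. }
    rewrite <- (rsum_const (cos (INR m * theta))). apply rsum_ext. intros l _.
    induction l as [|l IH]; [f_equal; simpl; ring|].
    rewrite S_INR. replace (INR m * theta + (INR l + 1) * alpha)
      with (INR m * theta + INR l * alpha + alpha) by ring.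
    rewrite cos_plus, Hc, Hs', IH. ring.
  - left. intros theta. rewrite E.
    apply Rmult_eq_reg_l with (2 * sin (alpha / 2)); [|lra].
    rewrite rsum_cos_progression, Rmult_0_r.
    replace (INR m * theta + INR n * alpha - alpha / 2)
      with (INR m * theta - alpha / 2 + 2 * PI * INR m) by (unfold alpha; field; assumption).
    rewrite (periodic_nat sin _ _ periodic_sin). ring.
Qed.

Lemma gon_cos_0 (n : nat) (theta : R) : (2 <= n)%nat -> gon n cos theta = 0.
Proof.
  intros Hn. assert (Hn0 : INR n <> 0) by (apply not_0_INR; lia).
  assert (HS : sin (PI / INR n) <> 0).
  { apply Rgt_not_eq. assert (H := arc_bounds n 1 ltac:(lia)). simpl in H.
    rewrite Rmult_1_r in H. apply sin_gt_0; lra. }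
  replace (gon n cos theta) with
    (rsum (fun l => cos (theta + INR l * (2 * PI / INR n))) n).
  2: { apply rsum_ext. intros l _. f_equal. field. assumption. }
  apply Rmult_eq_reg_l with (2 * sin (2 * PI / INR n / 2)).
  2: { replace (2 * PI / INR n / 2) with (PI / INR n) by (field; assumption). lra. }
  rewrite rsum_cos_progression.
  replace (theta + INR n * (2 * PI / INR n) - 2 * PI / INR n / 2)
    with (theta - 2 * PI / INR n / 2 + 2 * PI) by (field; assumption).
  rewrite periodic_sin. ring.
Qed.

(** * Functions with nonnegative cosine coefficients *)

(** Closure under pointwise limits stands in for infinite cosine series: induction on the derivation
    replaces all bookkeeping of coefficients and their convergence. *)
Inductive cos_positive : (R -> R) -> Prop :=
| cos_positive_cos (m : nat) : cos_positive (fun x => cos (INR m * x))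
| cos_positive_lin (a b : R) (f g : R -> R) : 0 <= a -> 0 <= b ->
    cos_positive f -> cos_positive g -> cos_positive (fun x => a * f x + b * g x)
| cos_positive_lim (u : nat -> R -> R) (f : R -> R) :
    (forall k, cos_positive (u k)) ->
    (forall x, is_lim_seq (fun k => u k x) (f x)) -> cos_positive f.

Lemma cos_positive_ext (f g : R -> R) :
  (forall x, f x = g x) -> cos_positive f -> cos_positive g.
Proof.
  intros H Hf. apply (cos_positive_lim (fun _ => f)); [auto|].
  intros x. rewrite <- H. apply is_lim_seq_const.
Qed.

Lemma cos_positive_one : cos_positive (fun _ => 1).
Proof.
  apply (cos_positive_ext (fun x => cos (INR 0 * x))); [|constructor].
  intros x. simpl. rewrite Rmult_0_l. apply cos_0.
Qed.

Lemma cos_positive_scal (a : R) (f : R -> R) :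
  0 <= a -> cos_positive f -> cos_positive (fun x => a * f x).
Proof.
  intros Ha Hf. apply (cos_positive_ext (fun x => a * f x + 0 * f x)); [intros; ring|].
  apply cos_positive_lin; auto with real.
Qed.

Lemma cos_positive_plus (f g : R -> R) :
  cos_positive f -> cos_positive g -> cos_positive (fun x => f x + g x).
Proof.
  intros Hf Hg. apply (cos_positive_ext (fun x => 1 * f x + 1 * g x)); [intros; ring|].
  apply cos_positive_lin; auto with real.
Qed.

(** The formula for a product of two cosines has coefficients [1 / 2]. Limits are taken in one
    factor at a time, so pointwise convergence is enough. *)
Lemma cos_positive_mult (f g : R -> R) :
  cos_positive f -> cos_positive g -> cos_positive (fun x => f x * g x).
Proof.
  intros Hf Hg. induction Hf as [m|a b f1 f2 Ha Hb H1 IH1 H2 IH2|u f Hu IH Hlim].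
  - induction Hg as [k|a b g1 g2 Ha Hb H1 IH1 H2 IH2|v g Hv IH Hlim].
    + destruct (Nat.le_ge_cases m k) as [H|H].
      * apply (cos_positive_ext
          (fun x => /2 * cos (INR (k + m) * x) + /2 * cos (INR (k - m) * x)));
          [|apply cos_positive_lin; try lra; constructor].
        intros x. rewrite plus_INR, minus_INR by assumption.
        rewrite Rmult_plus_distr_r, Rmult_minus_distr_r, cos_plus, cos_minus. field.
      * apply (cos_positive_ext
          (fun x => /2 * cos (INR (m + k) * x) + /2 * cos (INR (m - k) * x)));
          [|apply cos_positive_lin; try lra; constructor].
        intros x. rewrite plus_INR, minus_INR by assumption.
        rewrite Rmult_plus_distr_r, Rmult_minus_distr_r, cos_plus, cos_minus. field.
    + eapply cos_positive_ext; [|exact (cos_positive_lin a b _ _ Ha Hb IH1 IH2)].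
      intros x. simpl. ring.
    + apply (cos_positive_lim _ _ IH). intros x. apply is_lim_seq_mult'; [|apply Hlim].
      apply is_lim_seq_const.
  - eapply cos_positive_ext; [|exact (cos_positive_lin a b _ _ Ha Hb IH1 IH2)].
    intros x. simpl. ring.
  - apply (cos_positive_lim _ _ IH). intros x. apply is_lim_seq_mult'; [apply Hlim|].
    apply is_lim_seq_const.
Qed.

Lemma is_lim_seq_nonneg (u : nat -> R) (l : R) :
  (forall k, 0 <= u k) -> is_lim_seq u l -> 0 <= l.
Proof.
  intros Hu Hl. exact (is_lim_seq_le (fun _ => 0) u 0 l Hu (is_lim_seq_const 0) Hl).
Qed.

(** For a single cosine the polygon sum is either zero or [n cos (m theta)], largest in absolute
    value at [0]. A polygon sum is finite, so the inequalities survive pointwise limits. *)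
Lemma cos_positive_gon (n : nat) (f : R -> R) : (1 <= n)%nat -> cos_positive f ->
  0 <= gon n f 0 + gon n f (PI / INR n) /\ 0 <= gon n f 0 - gon n f (PI / INR n).
Proof.
  intros Hn Hf. induction Hf as [m|a b f1 f2 Ha Hb H1 IH1 H2 IH2|u f Hu IH Hlim].
  - destruct (gon_cos n m Hn) as [H|H]; rewrite !H; [lra|].
    rewrite Rmult_0_r, cos_0. assert (HB := COS_bound (INR m * (PI / INR n))).
    assert (0 <= INR n) by apply pos_INR. nra.
  - rewrite !gon_lin. nra.
  - assert (L : forall theta, is_lim_seq (fun k => gon n (u k) theta) (gon n f theta)).
    { intros theta. apply (is_lim_seq_rsum
        (fun j l => u j (theta + 2 * PI * INR l / INR n))). intros k. apply Hlim. }
    split.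
    + apply (is_lim_seq_nonneg (fun k => gon n (u k) 0 + gon n (u k) (PI / INR n)));
        [intros; apply IH|]. apply is_lim_seq_plus'; apply L.
    + apply (is_lim_seq_nonneg (fun k => gon n (u k) 0 - gon n (u k) (PI / INR n)));
        [intros; apply IH|]. apply is_lim_seq_minus'; apply L.
Qed.

Lemma cos_positive_pow (f : R -> R) (k : nat) :
  cos_positive f -> cos_positive (fun x => f x ^ k).
Proof.
  intros Hf. induction k as [|k IH]; simpl; [apply cos_positive_one|].
  apply (cos_positive_mult f _ Hf IH).
Qed.

Lemma rsum_geom (y : R) (k : nat) : (1 - y) * rsum (fun j => y ^ j) k = 1 - y ^ k.
Proof. induction k as [|k IH]; simpl; [ring|rewrite Rmult_plus_distr_l, IH; ring]. Qed.

Lemma cos_positive_rsum (f : nat -> R -> R) (k : nat) :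
  (forall j, cos_positive (f j)) -> cos_positive (fun x => rsum (fun j => f j x) k).
Proof.
  intros H. induction k as [|k IH]; simpl.
  - apply (cos_positive_ext (fun _ => 0 * 1)); [intros; ring|].
    apply cos_positive_scal; [lra|apply cos_positive_one].
  - apply cos_positive_plus; auto.
Qed.

Lemma cos_positive_inv (f : R -> R) : cos_positive f -> (forall x, Rabs (f x) < 1) ->
  cos_positive (fun x => / (1 - f x)).
Proof.
  intros Hf Hb.
  apply (cos_positive_lim (fun k x => rsum (fun j => f x ^ j) k)).
  - intros k. apply cos_positive_rsum. intros j. apply cos_positive_pow, Hf.
  - intros x. assert (Hx := Hb x).
    assert (f x <> 1) by (intros E; rewrite E, Rabs_R1 in Hx; lra).
    apply (is_lim_seq_ext (fun k => / (1 - f x) * (1 - f x ^ k))).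
    { intros k. rewrite <- rsum_geom. field. lra. }
    replace (Finite (/ (1 - f x))) with (Finite (/ (1 - f x) * (1 - 0)))
      by (f_equal; ring).
    apply is_lim_seq_mult'; [apply is_lim_seq_const|].
    apply is_lim_seq_minus'; [apply is_lim_seq_const|].
    apply is_lim_seq_geom, Hx.
Qed.

Lemma is_lim_seq_geom_bound (u : nat -> R) (l C q : R) : 0 <= q < 1 ->
  (forall k, Rabs (u k - l) <= C * q ^ k) -> is_lim_seq u l.
Proof.
  intros Hq H. apply is_lim_seq_spec. intros eps.
  assert (L := is_lim_seq_geom q ltac:(rewrite Rabs_pos_eq; lra)).
  apply (is_lim_seq_scal_l _ C) in L. simpl in L. rewrite Rmult_0_r in L.
  apply is_lim_seq_spec in L. destruct (L eps) as [N HN]. exists N. intros k Hk.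
  specialize (HN k Hk). specialize (H k). rewrite Rminus_0_r in HN.
  apply Rabs_lt_between in HN. lra.
Qed.

(* [1 - sqrt (1 - x)] is the attracting fixed point of [y |-> (x + y^2)/2], whose iterates
   are polynomials in [x] with nonnegative coefficients. *)
Fixpoint sqrt_iter (x : R) (k : nat) : R :=
  match k with O => 0 | S j => / 2 * x + / 2 * (sqrt_iter x j * sqrt_iter x j) end.

Lemma sqrt_iter_lim (t x : R) : 0 <= t < 1 -> Rabs x <= t ->
  is_lim_seq (sqrt_iter x) (1 - sqrt (1 - x)).
Proof.
  intros Ht Hx. apply Rabs_le_between in Hx.
  set (r := 1 - sqrt (1 - t)). set (y := 1 - sqrt (1 - x)).
  assert (St := sqrt_sqrt (1 - t) ltac:(lra)).
  assert (Sx := sqrt_sqrt (1 - x) ltac:(lra)).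
  assert (P1 : 0 < sqrt (1 - t)) by (apply sqrt_lt_R0; lra).
  assert (P2 : 0 < sqrt (1 - x)) by (apply sqrt_lt_R0; lra).
  assert (Hr : r = / 2 * t + / 2 * (r * r)) by (unfold r; nra).
  assert (Hy : y = / 2 * x + / 2 * (y * y)) by (unfold y; nra).
  assert (Hr0 : 0 <= r < 1) by (unfold r; split; nra).
  assert (Hy1 : -1 < y < 1) by (unfold y; split; nra).
  (* [r] is the fixed point for the parameter [t], which dominates because the iteration has
     nonnegative coefficients. *)
  assert (B : forall k, Rabs (sqrt_iter x k) <= r).
  { induction k as [|k IH]; simpl; [rewrite Rabs_R0; lra|].
    apply Rabs_le_between in IH. apply Rabs_le_between. split; nra. }
  (* Each error is multiplied by half of iterate plus limit; these are at most [r] and [1] in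
     absolute value. *)
  set (q := (1 + r) / 2).
  assert (C : forall k, Rabs (sqrt_iter x k - y) <= Rabs y * q ^ k).
  { induction k as [|k IH]; [simpl; rewrite Rminus_0_l, Rabs_Ropp; lra|].
    replace (sqrt_iter x (S k) - y)
      with ((sqrt_iter x k - y) * ((sqrt_iter x k + y) / 2)).
    2: { rewrite Hy at 3. simpl. field. }
    rewrite Rabs_mult. simpl.
    replace (Rabs y * (q * q ^ k)) with ((Rabs y * q ^ k) * q) by ring.
    apply Rmult_le_compat; try apply Rabs_pos; [exact IH|].
    specialize (B k). apply Rabs_le_between in B. apply Rabs_le_between. unfold q. lra. }
  apply (is_lim_seq_geom_bound _ _ (Rabs y) q); [unfold q; lra|exact C].
Qed.

Lemma cos_positive_inv_sqrt (f : R -> R) (t : R) : 0 <= t < 1 -> cos_positive f ->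
  (forall x, Rabs (f x) <= t) -> cos_positive (fun x => / sqrt (1 - f x)).
Proof.
  intros Ht Hf Hb.
  apply (cos_positive_ext (fun x => / (1 - (1 - sqrt (1 - f x))))).
  { intros x. f_equal. ring. }
  apply cos_positive_inv.
  - apply (cos_positive_lim (fun k x => sqrt_iter (f x) k)).
    + induction k as [|k IH]; simpl.
      * apply (cos_positive_ext (fun _ => 0 * 1)); [intros; ring|].
        apply cos_positive_scal; [lra|apply cos_positive_one].
      * apply cos_positive_lin; try lra; [assumption|]. apply cos_positive_mult; exact IH.
    + intros x. apply (sqrt_iter_lim t); auto.
  - intros x. specialize (Hb x). apply Rabs_le_between in Hb.
    assert (Sx := sqrt_sqrt (1 - f x) ltac:(lra)).
    assert (0 < sqrt (1 - f x)) by (apply sqrt_lt_R0; lra).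
    apply Rabs_lt_between. split; nra.
Qed.

(** * Attraction of a regular polygon *)

(* Inward radial and tangential attraction felt at distance [r] from the origin, due to
   a unit mass at distance [s] and relative angle [x]. A collision contributes
   [0 * / 0 = 0], so that a body does not act on itself. *)
Definition rad (r s x : R) : R :=
  (r - s * cos x) / sqrt (r ^ 2 + s ^ 2 - 2 * r * s * cos x) ^ 3.

Definition tng (r s x : R) : R :=
  s * sin x / sqrt (r ^ 2 + s ^ 2 - 2 * r * s * cos x) ^ 3.

Lemma periodic_rad (r s : R) : periodic (rad r s).
Proof. intros x. unfold rad. rewrite periodic_cos. reflexivity. Qed.

Lemma periodic_tng (r s : R) : periodic (tng r s).
Proof. intros x. unfold tng. rewrite periodic_cos, periodic_sin. reflexivity. Qed.

Lemma rad_even (r s x : R) : rad r s (- x) = rad r s x.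
Proof. unfold rad. rewrite cos_neg. reflexivity. Qed.

Lemma tng_odd (r s x : R) : tng r s (- x) = - tng r s x.
Proof. unfold tng. rewrite cos_neg, sin_neg. unfold Rdiv. ring. Qed.

Lemma rad_scale (k r s x : R) : 0 < k -> rad (k * r) (k * s) x = / k ^ 2 * rad r s x.
Proof.
  intros Hk. unfold rad.
  replace ((k * r) ^ 2 + (k * s) ^ 2 - 2 * (k * r) * (k * s) * cos x)
    with (k ^ 2 * (r ^ 2 + s ^ 2 - 2 * r * s * cos x)) by ring.
  rewrite sqrt_mult_alt by nra. rewrite sqrt_pow2 by lra.
  unfold Rdiv. rewrite Rpow_mult_distr, Rinv_mult.
  set (q := / sqrt _ ^ 3). field. lra.
Qed.

Lemma rad_r_0 (r x : R) : 0 < r -> rad r 0 x = / r ^ 2.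
Proof.
  intros Hr. unfold rad.
  replace (r ^ 2 + 0 ^ 2 - 2 * r * 0 * cos x) with (r ^ 2) by ring.
  rewrite sqrt_pow2 by lra. field. lra.
Qed.

Lemma rad_0_s (s x : R) : rad 0 s x = (- s / sqrt (s ^ 2) ^ 3) * cos x.
Proof.
  unfold rad. replace (0 ^ 2 + s ^ 2 - 2 * 0 * s * cos x) with (s ^ 2) by ring.
  unfold Rdiv. ring.
Qed.

Lemma rad_unit (x : R) : 0 <= sin (x / 2) -> rad 1 1 x = / 4 * / sin (x / 2).
Proof.
  intros Hs. unfold rad.
  replace (cos x) with (1 - 2 * sin (x / 2) * sin (x / 2))
    by (rewrite <- cos_2a_sin; f_equal; field).
  set (s := sin (x / 2)) in *.
  replace (1 ^ 2 + 1 ^ 2 - 2 * 1 * 1 * (1 - 2 * s * s)) with ((2 * s) ^ 2) by ring.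
  rewrite sqrt_pow2 by lra.
  (* At the body's own position both sides vanish by [/ 0 = 0]. *)
  destruct (Req_dec s 0) as [->|Hs0]; [|field; assumption].
  rewrite Rinv_0. unfold Rdiv. ring.
Qed.

Lemma csc_double (n l : nat) : (1 <= n)%nat -> csc (2 * n) (2 * l) = csc n l.
Proof.
  intros Hn. unfold csc. do 2 f_equal. rewrite !mult_INR. simpl.
  field. apply not_0_INR. lia.
Qed.

Lemma gon_rad_unit_even (n : nat) : (1 <= n)%nat ->
  gon n (rad 1 1) 0 = / 4 * rsum (fun l => csc (2 * n) (2 * l)) n.
Proof.
  intros Hn. assert (Hn0 : INR n <> 0) by (apply not_0_INR; lia).
  unfold gon. rewrite <- rsum_scal. apply rsum_ext. intros l Hl.
  rewrite csc_double by assumption. unfold csc.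
  assert (E : (0 + 2 * PI * INR l / INR n) / 2 = PI * INR l / INR n) by (field; assumption).
  rewrite rad_unit; rewrite E; [reflexivity|].
  destruct l as [|l].
  - simpl. replace (PI * 0 / INR n) with 0 by (field; assumption). rewrite sin_0; lra.
  - apply sin_ge_0; apply Rlt_le, arc_bounds; lia.
Qed.

Lemma gon_rad_unit_odd (n : nat) : (1 <= n)%nat ->
  gon n (rad 1 1) (PI / INR n) = / 4 * rsum (fun l => csc (2 * n) (2 * l + 1)) n.
Proof.
  intros Hn. assert (Hn0 : INR n <> 0) by (apply not_0_INR; lia).
  unfold gon. rewrite <- rsum_scal. apply rsum_ext. intros l Hl. unfold csc.
  assert (E : (PI / INR n + 2 * PI * INR l / INR n) / 2
    = PI * INR (2 * l + 1) / INR (2 * n)).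
  { rewrite plus_INR, !mult_INR. simpl. field. assumption. }
  rewrite rad_unit; rewrite E; [reflexivity|].
  apply sin_ge_0; apply Rlt_le, arc_bounds; lia.
Qed.

Lemma gon_rad_unit_lt (n : nat) : (1 <= n)%nat ->
  0 <= gon n (rad 1 1) 0 < gon n (rad 1 1) (PI / INR n).
Proof.
  intros Hn. rewrite gon_rad_unit_even, gon_rad_unit_odd by assumption.
  assert (H := csc_even_lt_odd n Hn).
  assert (H0 := csc_sum_nonneg n). unfold csc_sum in H0.
  rewrite (rsum_ext (csc n) (fun l => csc (2 * n) (2 * l))) in H0
    by (intros; rewrite csc_double; auto). lra.
Qed.

Lemma gon_rad_unit_csc (n : nat) : (1 <= n)%nat -> gon n (rad 1 1) 0 = / 4 * csc_sum n.
Proof.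
  intros Hn. rewrite gon_rad_unit_even by assumption. f_equal. apply rsum_ext.
  intros; apply csc_double; assumption.
Qed.

Lemma gon_rad_unit_sum (n : nat) : (1 <= n)%nat ->
  gon n (rad 1 1) 0 + gon n (rad 1 1) (PI / INR n) = / 4 * csc_sum (2 * n).
Proof.
  intros Hn. rewrite gon_rad_unit_even, gon_rad_unit_odd by assumption.
  unfold csc_sum. rewrite rsum_even_odd. ring.
Qed.

(** * Interaction of two rings of different radii *)

Section Inside.

Variable rho : R.
Hypothesis Hrho : 0 < rho < 1.

Let d (x : R) : R := 1 + rho ^ 2 - 2 * rho * cos x.

Let d_pos (x : R) : 0 < d x.
Proof.
  unfold d. assert (H := COS_bound x).
  assert (0 <= rho * (1 - cos x)) by (apply Rmult_le_pos; lra).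
  assert (0 < (1 - rho) ^ 2) by (apply pow_lt; lra). nra.
Qed.

(** [h] is the potential of a unit mass, and [q] is the part of half the Poisson kernel without
    constant term. Both attractions between the rings are expressed through them. *)
Let h (x : R) : R := / sqrt (d x).
Let q (x : R) : R := ((1 - rho ^ 2) / d x - 1) / 2.

(** Taking [1 + rho ^ 2] out of [d] leaves [1 - t cos x] with [t < 1]. *)
Lemma cos_positive_potential : cos_positive h.
Proof.
  set (t := 2 * rho / (1 + rho ^ 2)).
  assert (0 < 1 + rho ^ 2) by nra.
  assert (Ht : 0 <= t < 1).
  { unfold t. split; [apply Rdiv_le_0_compat; lra|].
    apply Rmult_lt_reg_r with (1 + rho ^ 2); [assumption|].
    unfold Rdiv. rewrite Rmult_assoc, Rinv_l by lra. nra. }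
  apply (cos_positive_ext (fun x => / sqrt (1 + rho ^ 2) * / sqrt (1 - t * cos (INR 1 * x)))).
  { intros x. unfold h. rewrite <- Rinv_mult, <- sqrt_mult_alt by lra.
    do 2 f_equal. unfold d, t. simpl (INR 1). rewrite Rmult_1_l. field. nra. }
  apply cos_positive_scal.
  { apply Rlt_le, Rinv_0_lt_compat, sqrt_lt_R0. assumption. }
  apply (cos_positive_inv_sqrt _ t Ht).
  - apply cos_positive_scal; [lra|constructor].
  - intros x. assert (B := COS_bound (INR 1 * x)). apply Rabs_le_between. split; nra.
Qed.

(* The Poisson kernel [(1 - rho^2) / d] equals [1 + 2 sum_(k >= 1) rho^k cos (k x)]. *)
Lemma cos_positive_poisson : cos_positive q.
Proof.
  apply (cos_positive_lim
    (fun K x => rsum (fun k => rho ^ S k * cos (INR (S k) * x)) K)).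
  { intros K. apply (cos_positive_rsum (fun k x => rho ^ S k * cos (INR (S k) * x))).
    intros k. apply cos_positive_scal; [apply pow_le; lra|constructor]. }
  intros x.
  set (U := fun K => rsum (fun k => rho ^ S k * cos (INR (S k) * x)) K).
  (* Multiplication by [d x] telescopes the sum, since [2 cos x cos (k x) = cos ((k + 1) x) + cos
     ((k - 1) x)]. *)
  assert (E : forall K, d x * (1 + 2 * U K) = 1 - rho ^ 2
     - 2 * rho ^ S K * cos (INR (S K) * x) + 2 * rho ^ S (S K) * cos (INR K * x)).
  { induction K as [|K IH].
    - unfold U, d. simpl. rewrite Rmult_0_l, cos_0, Rmult_1_l. ring.
    - unfold U in *. cbn [rsum].
      replace (d x * (1 + 2 * (rsum (fun k => rho ^ S k * cos (INR (S k) * x)) K +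
         rho ^ S K * cos (INR (S K) * x)))) with
        (d x * (1 + 2 * rsum (fun k => rho ^ S k * cos (INR (S k) * x)) K)
          + d x * (2 * (rho ^ S K * cos (INR (S K) * x)))) by ring.
      rewrite IH. unfold d.
      replace (INR (S (S K)) * x) with (INR (S K) * x + x) by (rewrite (S_INR (S K)); ring).
      replace (INR K * x) with (INR (S K) * x - x) by (rewrite (S_INR K); ring).
      rewrite cos_plus, cos_minus. simpl pow. ring. }
  assert (D := d_pos x).
  apply (is_lim_seq_geom_bound _ _ (2 / d x) rho); [lra|].
  intros K. fold (U K). specialize (E K).
  assert (B1 := COS_bound (INR (S K) * x)). assert (B2 := COS_bound (INR K * x)).
  replace (U K - q x) with (rho ^ K * rho *
    (rho * cos (INR K * x) - cos (INR (S K) * x)) / d x).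
  2: { unfold q. replace (U K) with (((d x * (1 + 2 * U K)) / d x - 1) / 2) by (field; lra).
       rewrite E. simpl. field. lra. }
  assert (P : 0 < rho ^ K) by (apply pow_lt; lra).
  replace (2 / d x * rho ^ K) with (rho ^ K * 2 / d x) by (field; lra).
  unfold Rdiv. rewrite Rabs_mult, (Rabs_pos_eq (/ d x)) by (apply Rlt_le, Rinv_0_lt_compat, D).
  apply Rmult_le_compat_r; [apply Rlt_le, Rinv_0_lt_compat, D|].
  rewrite Rmult_assoc, Rabs_mult, (Rabs_pos_eq (rho ^ K)) by lra.
  apply Rmult_le_compat_l; [lra|]. apply Rabs_le_between.
  assert (-1 <= rho * cos (INR K * x) <= 1) by (split; nra). split; nra.
Qed.

Lemma rad_one_rho (x : R) : rad 1 rho x = h x * (1 + q x).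
Proof.
  unfold rad, h, q. replace (1 ^ 2 + rho ^ 2 - 2 * 1 * rho * cos x) with (d x) by (unfold d; ring).
  assert (D := d_pos x). assert (S0 := sqrt_lt_R0 _ D).
  replace (1 - rho * cos x) with ((d x + 1 - rho ^ 2) / 2) by (unfold d; field).
  assert (S2 := sqrt_sqrt (d x) (Rlt_le _ _ D)). set (s := sqrt (d x)) in *.
  rewrite <- S2. field. lra.
Qed.

Lemma rad_rho_one (x : R) : rad rho 1 x = - / rho * (h x * q x).
Proof.
  unfold rad, h, q. replace (rho ^ 2 + 1 ^ 2 - 2 * rho * 1 * cos x) with (d x) by (unfold d; ring).
  assert (D := d_pos x). assert (S0 := sqrt_lt_R0 _ D).
  replace (rho - 1 * cos x) with ((d x - 1 + rho ^ 2) / (2 * rho)) by (unfold d; field; lra).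
  assert (S2 := sqrt_sqrt (d x) (Rlt_le _ _ D)). set (s := sqrt (d x)) in *.
  rewrite <- S2. field. lra.
Qed.

(** The difference has the sign of [(s - w) ^ 2 + w (1 - w)], where [s ^ 2 = d x]. The Poisson
    kernel, whose constant term is [1], then yields the lower bound [2n] for the attraction at the
    two directions together. *)
Lemma rad_one_rho_ge_poisson (x : R) : 1 + 2 * q x <= rad 1 rho x.
Proof.
  rewrite rad_one_rho. unfold h, q.
  assert (D := d_pos x). assert (S0 := sqrt_lt_R0 _ D).
  assert (S2 := sqrt_sqrt (d x) (Rlt_le _ _ D)).
  set (s := sqrt (d x)) in *. rewrite <- S2. set (w := 1 - rho ^ 2).
  assert (Hw : 0 < w < 1) by (unfold w; nra).
  replace (/ s * (1 + (w / (s * s) - 1) / 2))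
    with (1 + 2 * ((w / (s * s) - 1) / 2) + (s * s + w - 2 * w * s) / (2 * s ^ 3))
    by (field; lra).
  assert (0 <= (s * s + w - 2 * w * s) / (2 * s ^ 3)); [|lra].
  apply Rdiv_le_0_compat; [|assert (0 < s ^ 3) by (apply pow_lt; lra); lra].
  assert (0 <= (s - w) ^ 2) by apply pow2_ge_0. nra.
Qed.

Variable n : nat.
Hypothesis Hn : (1 <= n)%nat.

Lemma gon_rad_inside :
  gon n (rad 1 rho) (PI / INR n) <= gon n (rad 1 rho) 0 /\
  2 * INR n <= gon n (rad 1 rho) 0 + gon n (rad 1 rho) (PI / INR n) /\
  gon n (rad rho 1) 0 <= gon n (rad rho 1) (PI / INR n) /\
  gon n (rad rho 1) 0 + gon n (rad rho 1) (PI / INR n) <= 0.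
Proof.
  assert (Hh := cos_positive_potential). assert (Hq := cos_positive_poisson).
  assert (H1 : cos_positive (rad 1 rho)).
  { apply (cos_positive_ext (fun x => h x * (1 + q x))); [intros; symmetry; apply rad_one_rho|].
    apply cos_positive_mult; [assumption|].
    apply cos_positive_plus; [apply cos_positive_one|assumption]. }
  destruct (cos_positive_gon n _ Hn H1) as [_ A1].
  destruct (cos_positive_gon n _ Hn Hq) as [A2 _].
  destruct (cos_positive_gon n _ Hn (cos_positive_mult _ _ Hh Hq)) as [A3 A4].
  assert (A5 : forall theta, INR n + 2 * gon n q theta <= gon n (rad 1 rho) theta).
  { intros theta. rewrite <- (Rmult_1_r (INR n)), <- (rsum_const 1).
    unfold gon. rewrite <- (Rmult_1_l (rsum (fun _ => 1) n)), <- rsum_lin.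
    apply rsum_le. intros k _. rewrite Rmult_1_l. apply rad_one_rho_ge_poisson. }
  assert (A6 : forall theta, gon n (rad rho 1) theta = - / rho * gon n (fun x => h x * q x) theta).
  { intros theta. rewrite (gon_ext _ _ _ _ rad_rho_one). apply rsum_scal. }
  rewrite !A6. assert (B0 := A5 0). assert (B1 := A5 (PI / INR n)).
  assert (R0 : 0 < / rho) by (apply Rinv_0_lt_compat; lra).
  repeat split; try lra; nra.
Qed.

End Inside.

(** Attraction is homogeneous of degree [-2]. With [s = 1 / rho] the two kinds of interaction change
    places, which transfers the bounds for [rho < 1] to [rho > 1]. *)
Lemma gon_rad_dual (n : nat) (rho theta : R) : 0 < rho ->
  gon n (rad 1 rho) theta = (/ rho) ^ 2 * gon n (rad (/ rho) 1) theta /\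
  rho ^ 2 * gon n (rad rho 1) theta = gon n (rad 1 (/ rho)) theta.
Proof.
  intros Hrho. unfold gon. rewrite <- !rsum_scal. split; apply rsum_ext; intros k _.
  - replace (rad 1 rho) with (rad (rho * / rho) (rho * 1)) by (f_equal; field; lra).
    rewrite rad_scale by assumption. rewrite pow_inv. reflexivity.
  - replace (rad rho 1) with (rad (rho * 1) (rho * / rho)) by (f_equal; field; lra).
    rewrite rad_scale by assumption. field. lra.
Qed.

(** * Equations of a relative equilibrium *)

Definition radius (n : nat) (rho : R) (k : nat) : R :=
  if Nat.eqb k 0 then 0 else if Nat.leb k n then rho else 1.

Definition angle (n k : nat) : R :=
  if Nat.eqb k 0 then 0
  else if Nat.leb k n then 2 * PI * INR (k - 1) / INR n
  else PI * INR (k - n - 1) / INR n.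

Lemma rotate_pos (n : nat) (rho : R) (k : nat) (t : R) :
  rotate (Defs.pos n rho k) t =
  (radius n rho k * cos (angle n k + t), radius n rho k * sin (angle n k + t)).
Proof.
  rewrite cos_plus, sin_plus. unfold rotate, Defs.pos, radius, angle.
  destruct (Nat.eqb k 0); [|destruct (Nat.leb k n)]; simpl; f_equal; ring.
Qed.

Lemma sum_except_rsum (N i : nat) (f : nat -> R) : f i = 0 -> sum_except N i f = rsum f N.
Proof.
  intros Hi. unfold sum_except.
  assert (E : forall l, fold_right Rplus 0
      (map f (filter (fun j => negb (Nat.eqb j i)) l)) = fold_right Rplus 0 (map f l)).
  { induction l as [|x l IH]; [reflexivity|]. simpl.
    destruct (Nat.eqb_spec x i) as [->|]; simpl; rewrite IH; [rewrite Hi; ring|reflexivity]. }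
  rewrite E. clear E Hi.
  assert (E : forall (l : list R) x, fold_right Rplus 0 (l ++ x :: nil) = fold_right Rplus 0 l + x).
  { induction l as [|y l IH]; intros x; simpl; [ring|rewrite IH; ring]. }
  induction N as [|N IH]; [reflexivity|].
  rewrite seq_S, map_app. simpl map at 2. rewrite E, IH. reflexivity.
Qed.

Lemma is_derive_n_2_rotation (a b t : R) :
  is_derive_n (fun s => a * cos s + b * sin s) 2 t (- (a * cos t + b * sin t)).
Proof.
  apply (is_derive_ext (fun s => b * cos s - a * sin s)).
  - intros s. symmetry. apply is_derive_unique. auto_derive; [trivial|ring].
  - auto_derive; [trivial|ring].
Qed.

Lemma is_derive_n_rotate (p : R * R) (t : R) :
  is_derive_n (fun s => fst (rotate p s)) 2 t (- fst (rotate p t)) /\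
  is_derive_n (fun s => snd (rotate p s)) 2 t (- snd (rotate p t)).
Proof.
  split.
  - apply (is_derive_n_ext (fun s => fst p * cos s + (- snd p) * sin s)).
    { intros s. simpl. ring. }
    replace (- fst (rotate p t)) with (- (fst p * cos t + (- snd p) * sin t)) by (simpl; ring).
    apply is_derive_n_2_rotation.
  - apply (is_derive_n_ext (fun s => snd p * cos s + fst p * sin s)).
    { intros s. simpl. ring. }
    replace (- snd (rotate p t)) with (- (snd p * cos t + fst p * sin t)) by (simpl; ring).
    apply is_derive_n_2_rotation.
Qed.

Lemma pdist_polar (r s u v : R) :
  pdist (r * cos u, r * sin u) (s * cos v, s * sin v) =
  sqrt (r ^ 2 + s ^ 2 - 2 * r * s * cos (v - u)).
Proof.
  unfold pdist. simpl fst. simpl snd. f_equal. rewrite cos_minus.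
  assert (Hu := sin2_cos2 u). assert (Hv := sin2_cos2 v). unfold Rsqr in *.
  replace (r ^ 2) with (r ^ 2 * (sin u * sin u + cos u * cos u)) by (rewrite Hu; ring).
  replace (s ^ 2) with (s ^ 2 * (sin v * sin v + cos v * cos v)) by (rewrite Hv; ring).
  ring.
Qed.

Lemma attraction_polar (r s u v : R) :
  (s * cos v - r * cos u) / pdist (r * cos u, r * sin u) (s * cos v, s * sin v) ^ 3 =
    - (cos u * rad r s (v - u) + sin u * tng r s (v - u)) /\
  (s * sin v - r * sin u) / pdist (r * cos u, r * sin u) (s * cos v, s * sin v) ^ 3 =
    - (sin u * rad r s (v - u) - cos u * tng r s (v - u)).
Proof.
  rewrite pdist_polar. unfold rad, tng.
  set (w := v - u). replace v with (u + w) by (unfold w; ring).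
  rewrite cos_plus, sin_plus. set (D := sqrt _ ^ 3).
  unfold Rdiv. split.
  - replace (s * (cos u * cos w - sin u * sin w) - r * cos u)
      with (- (cos u * (r - s * cos w) + sin u * (s * sin w))) by ring. ring.
  - replace (s * (sin u * cos w + cos u * sin w) - r * sin u)
      with (- (sin u * (r - s * cos w) - cos u * (s * sin w))) by ring. ring.
Qed.

Definition body_sum (n : nat) (rho : R) (m : mass_system) (f : R -> R -> R -> R) (i : nat) : R :=
  rsum (fun j => mass n m j *
    f (radius n rho i) (radius n rho j) (angle n j - angle n i)) (Nbodies n).

Lemma RE_solution_polar (n : nat) (rho : R) (m : mass_system) :
  RE_solution n rho m <-> forall i, (i < Nbodies n)%nat -> forall t,
    let u := angle n i + t in
    let X := body_sum n rho m rad i in let Y := body_sum n rho m tng i in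
    mass n m i * (radius n rho i * cos u) = mass n m i * (cos u * X + sin u * Y) /\
    mass n m i * (radius n rho i * sin u) = mass n m i * (sin u * X - cos u * Y).
Proof.
  assert (HX : forall i t, sum_except (Nbodies n) i (fun j =>
      mass n m i * mass n m j *
      (fst (rotate (Defs.pos n rho j) t) - fst (rotate (Defs.pos n rho i) t)) /
      pdist (rotate (Defs.pos n rho i) t) (rotate (Defs.pos n rho j) t) ^ 3) =
    - (mass n m i * (cos (angle n i + t) * body_sum n rho m rad i
         + sin (angle n i + t) * body_sum n rho m tng i))).
  { intros i t. rewrite sum_except_rsum by (unfold Rdiv; ring).
    unfold body_sum. rewrite <- rsum_lin, <- rsum_scal.
    rewrite <- rsum_opp.
    apply rsum_ext. intros j _. rewrite !rotate_pos. simpl fst.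
    destruct (attraction_polar (radius n rho i) (radius n rho j) (angle n i + t)
      (angle n j + t)) as [A _].
    unfold Rdiv in A |- *. rewrite Rmult_assoc, A.
    replace (angle n j + t - (angle n i + t)) with (angle n j - angle n i) by ring. ring. }
  assert (HY : forall i t, sum_except (Nbodies n) i (fun j =>
      mass n m i * mass n m j *
      (snd (rotate (Defs.pos n rho j) t) - snd (rotate (Defs.pos n rho i) t)) /
      pdist (rotate (Defs.pos n rho i) t) (rotate (Defs.pos n rho j) t) ^ 3) =
    - (mass n m i * (sin (angle n i + t) * body_sum n rho m rad i
         + - cos (angle n i + t) * body_sum n rho m tng i))).
  { intros i t. rewrite sum_except_rsum by (unfold Rdiv; ring).
    unfold body_sum. rewrite <- rsum_lin, <- rsum_scal.
    rewrite <- rsum_opp.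
    apply rsum_ext. intros j _. rewrite !rotate_pos. simpl snd.
    destruct (attraction_polar (radius n rho i) (radius n rho j) (angle n i + t)
      (angle n j + t)) as [_ A].
    unfold Rdiv in A |- *. rewrite Rmult_assoc, A.
    replace (angle n j + t - (angle n i + t)) with (angle n j - angle n i) by ring. ring. }
  split.
  - intros H i Hi t u X Y. destruct (H i Hi t) as [[ax [D1 E1]] [ay [D2 E2]]].
    destruct (is_derive_n_rotate (Defs.pos n rho i) t) as [D1' D2'].
    apply is_derive_n_unique in D1, D2, D1', D2'.
    rewrite D1 in D1'. rewrite D2 in D2'. rewrite HX in E1. rewrite HY in E2.
    rewrite rotate_pos in D1', D2'. simpl in D1', D2'.
    rewrite D1' in E1. rewrite D2' in E2. unfold u, X, Y. split; lra.
  - intros H i Hi t. destruct (H i Hi t) as [E1 E2]. cbv zeta in E1, E2.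
    destruct (is_derive_n_rotate (Defs.pos n rho i) t) as [D1 D2]. split.
    + exists (- fst (rotate (Defs.pos n rho i) t)). split; [exact D1|].
      rewrite HX, rotate_pos. simpl fst. lra.
    + exists (- snd (rotate (Defs.pos n rho i) t)). split; [exact D2|].
      rewrite HY, rotate_pos. simpl snd. lra.
Qed.

(** The [2n]-gon is read as two [n]-gons, of masses [m2] and [m3], half a step apart. *)
Lemma rsum_bodies (n : nat) (rho m0 m1 m2 m3 : R) (f : R -> R -> R) (phi : R) :
  (1 <= n)%nat ->
  rsum (fun j => mass n (m0, m1, m2, m3) j * f (radius n rho j) (angle n j - phi)) (Nbodies n) =
  m0 * f 0 (- phi) + m1 * gon n (f rho) (- phi) + m2 * gon n (f 1) (- phi)
    + m3 * gon n (f 1) (PI / INR n - phi).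
Proof.
  intros Hn. assert (Hn0 : INR n <> 0) by (apply not_0_INR; lia).
  replace (Nbodies n) with (S (n + 2 * n)) by (unfold Nbodies; lia).
  rewrite rsum_head, rsum_add, rsum_even_odd. unfold gon.
  rewrite <- !rsum_scal. rewrite <- !Rplus_assoc. f_equal; [f_equal; [f_equal|]|].
  - unfold mass, radius, angle. simpl. f_equal. f_equal. ring.
  - apply rsum_ext. intros k Hk. unfold mass, radius, angle. cbn [Nat.eqb].
    rewrite (proj2 (Nat.leb_le (S k) n)) by lia. do 2 f_equal.
    replace (S k - 1)%nat with k by lia. ring.
  - apply rsum_ext. intros k Hk. unfold mass, radius, angle. cbn [Nat.eqb].
    rewrite (proj2 (Nat.leb_gt (S (n + 2 * k)) n)) by lia.
    replace (S (n + 2 * k) - n - 1)%nat with (2 * k)%nat by lia.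
    rewrite Nat.even_even. do 2 f_equal. rewrite mult_INR. simpl. field. assumption.
  - apply rsum_ext. intros k Hk. unfold mass, radius, angle. cbn [Nat.eqb].
    rewrite (proj2 (Nat.leb_gt (S (n + (2 * k + 1))) n)) by lia.
    replace (S (n + (2 * k + 1)) - n - 1)%nat with (2 * k + 1)%nat by lia.
    rewrite Nat.even_odd. do 2 f_equal. rewrite plus_INR, mult_INR. simpl. field. assumption.
Qed.

Lemma body_classes (n : nat) (rho : R) (i : nat) : (1 <= n)%nat -> (i < Nbodies n)%nat ->
  (radius n rho i = 0) \/
  (exists k, radius n rho i = rho /\ angle n i = 2 * PI * INR k / INR n) \/
  (exists k, radius n rho i = 1 /\ angle n i = 2 * PI * INR k / INR n) \/
  (exists k, radius n rho i = 1 /\ angle n i = PI / INR n + 2 * PI * INR k / INR n).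
Proof.
  intros Hn Hi. assert (Hn0 : INR n <> 0) by (apply not_0_INR; lia).
  unfold radius, angle. destruct (Nat.eqb_spec i 0) as [|Hi0]; [left; reflexivity|right].
  destruct (Nat.leb_spec i n) as [Hin|Hin]; [left; exists (i - 1)%nat; auto|right].
  destruct (Nat.Even_or_Odd (i - n - 1)) as [[k Hk]|[k Hk]]; [left|right]; exists k;
    (split; [reflexivity|]); rewrite Hk, ?plus_INR, mult_INR; simpl; field; assumption.
Qed.

Lemma gon_rad_0_s (n : nat) (s theta : R) : (2 <= n)%nat -> gon n (rad 0 s) theta = 0.
Proof.
  intros Hn. rewrite (gon_ext _ _ _ _ (rad_0_s s)).
  set (c := - s / sqrt (s ^ 2) ^ 3).
  replace (gon n (fun x => c * cos x) theta) with (c * gon n cos theta)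
    by (symmetry; apply rsum_scal).
  rewrite gon_cos_0 by assumption. ring.
Qed.

Lemma gon_tng_0_s (n : nat) (s theta : R) : (2 <= n)%nat -> gon n (tng 0 s) theta = 0.
Proof.
  intros Hn. unfold gon.
  rewrite (rsum_ext _ (fun l => rad 0 s (theta + PI / 2 + 2 * PI * INR l / INR n))).
  - exact (gon_rad_0_s n s (theta + PI / 2) Hn).
  - intros l _. unfold tng, rad.
    set (x := theta + 2 * PI * INR l / INR n).
    replace (cos (theta + PI / 2 + 2 * PI * INR l / INR n)) with (- sin x).
    2: { rewrite sin_cos, Ropp_involutive. f_equal. unfold x. ring. }
    replace (0 ^ 2 + s ^ 2 - 2 * 0 * s * cos x) with (s ^ 2) by ring.
    replace (0 ^ 2 + s ^ 2 - 2 * 0 * s * - sin x) with (s ^ 2) by ring.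
    unfold Rdiv. ring.
Qed.

(** Each body off the origin lies on a common symmetry axis of the three [n]-gons. At the origin the
    attractions of each [n]-gon cancel because its vertices sum to zero, which takes [n >= 2]. *)
Lemma body_sum_tng (n : nat) (rho : R) (m : mass_system) (i : nat) :
  (2 <= n)%nat -> (i < Nbodies n)%nat -> body_sum n rho m tng i = 0.
Proof.
  intros Hn Hi. destruct m as [[[m0 m1] m2] m3]. unfold body_sum.
  rewrite (rsum_bodies n rho m0 m1 m2 m3 (tng (radius n rho i))) by lia.
  assert (E0 : tng (radius n rho i) 0 (- angle n i) = 0) by (unfold tng, Rdiv; ring).
  rewrite E0.
  assert (Z := fun r s => gon_odd n (tng r s) ltac:(lia) (periodic_tng r s) (tng_odd r s)).
  destruct (body_classes n rho i ltac:(lia) Hi)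
    as [->|[[k [-> ->]]|[[k [-> ->]]|[k [-> ->]]]]].
  - rewrite !gon_tng_0_s by assumption. ring.
  - rewrite <- (Rminus_0_l (2 * PI * INR k / INR n)).
    rewrite !gon_shift by (try lia; apply periodic_tng).
    rewrite !(proj1 (Z _ _)), (proj1 (proj2 (Z _ _))). ring.
  - rewrite <- (Rminus_0_l (2 * PI * INR k / INR n)).
    rewrite !gon_shift by (try lia; apply periodic_tng).
    rewrite !(proj1 (Z _ _)), (proj1 (proj2 (Z _ _))). ring.
  - replace (- (PI / INR n + 2 * PI * INR k / INR n))
      with (- (PI / INR n) - 2 * PI * INR k / INR n) by ring.
    replace (PI / INR n - (PI / INR n + 2 * PI * INR k / INR n))
      with (0 - 2 * PI * INR k / INR n) by ring.
    rewrite !gon_shift by (try lia; apply periodic_tng).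
    rewrite !(proj1 (Z _ _)), !(proj2 (proj2 (Z _ _))). ring.
Qed.

(** The radial equation of the inner or outer [n]-gon is multiplied by [rho ^ 2], so that [m0] and
    [m1] get the same coefficients as on the unit circle. *)
Definition balanced (n : nat) (rho : R) (m : mass_system) : Prop :=
  let '(m0, m1, m2, m3) := m in
  m0 + m1 * gon n (rad 1 rho) 0 + m2 * gon n (rad 1 1) 0
    + m3 * gon n (rad 1 1) (PI / INR n) = 1 /\
  m0 + m1 * gon n (rad 1 rho) (PI / INR n) + m2 * gon n (rad 1 1) (PI / INR n)
    + m3 * gon n (rad 1 1) 0 = 1 /\
  m0 + m1 * gon n (rad 1 1) 0 + m2 * (rho ^ 2 * gon n (rad rho 1) 0)
    + m3 * (rho ^ 2 * gon n (rad rho 1) (PI / INR n)) = rho ^ 3.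

Lemma gon_rad_diag (n : nat) (rho theta : R) : 0 < rho ->
  gon n (rad rho rho) theta = / rho ^ 2 * gon n (rad 1 1) theta.
Proof.
  intros Hrho. unfold gon. rewrite <- rsum_scal. apply rsum_ext. intros k _.
  rewrite <- rad_scale by assumption. rewrite Rmult_1_r. reflexivity.
Qed.

Lemma radial_forms (n : nat) (rho m0 m1 m2 m3 : R) (i k : nat) : (2 <= n)%nat -> 0 < rho ->
  let X := body_sum n rho (m0, m1, m2, m3) rad i in
  (radius n rho i = rho -> angle n i = 2 * PI * INR k / INR n ->
    rho ^ 2 * X = m0 + m1 * gon n (rad 1 1) 0 + m2 * (rho ^ 2 * gon n (rad rho 1) 0)
      + m3 * (rho ^ 2 * gon n (rad rho 1) (PI / INR n))) /\
  (radius n rho i = 1 -> angle n i = 2 * PI * INR k / INR n ->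
    X = m0 + m1 * gon n (rad 1 rho) 0 + m2 * gon n (rad 1 1) 0
      + m3 * gon n (rad 1 1) (PI / INR n)) /\
  (radius n rho i = 1 -> angle n i = PI / INR n + 2 * PI * INR k / INR n ->
    X = m0 + m1 * gon n (rad 1 rho) (PI / INR n) + m2 * gon n (rad 1 1) (PI / INR n)
      + m3 * gon n (rad 1 1) 0).
Proof.
  intros Hn Hrho X.
  unfold X, body_sum.
  rewrite (rsum_bodies n rho m0 m1 m2 m3 (rad (radius n rho i))) by lia.
  repeat split; intros -> ->.
  - rewrite <- (Rminus_0_l (2 * PI * INR k / INR n)).
    rewrite !gon_shift by (try lia; apply periodic_rad).
    rewrite rad_r_0, gon_rad_diag by assumption. field. lra.
  - rewrite <- (Rminus_0_l (2 * PI * INR k / INR n)).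
    rewrite !gon_shift by (try lia; apply periodic_rad).
    rewrite rad_r_0 by lra. field.
  - replace (- (PI / INR n + 2 * PI * INR k / INR n))
      with (- (PI / INR n) - 2 * PI * INR k / INR n) by ring.
    replace (PI / INR n - (PI / INR n + 2 * PI * INR k / INR n))
      with (0 - 2 * PI * INR k / INR n) by ring.
    rewrite !gon_shift by (try lia; apply periodic_rad).
    rewrite !gon_half_even by (try lia; try apply periodic_rad; apply rad_even).
    rewrite rad_r_0 by lra. field.
Qed.

Lemma RE_solution_balanced (n : nat) (rho : R) (m : mass_system) :
  (2 <= n)%nat -> 0 < rho -> mass_positive m ->
  (RE_solution n rho m <-> balanced n rho m).
Proof.
  intros Hn Hrho Hm. destruct m as [[[m0 m1] m2] m3]. destruct Hm as (P0 & P1 & P2 & P3).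
  assert (Hn0 : INR n <> 0) by (apply not_0_INR; lia).
  rewrite RE_solution_polar. split.
  - intros H.
    assert (K : forall i, (i < Nbodies n)%nat -> 0 < mass n (m0, m1, m2, m3) i ->
      body_sum n rho (m0, m1, m2, m3) rad i = radius n rho i).
    (* At this time the body is on the real axis, so its first coordinate isolates the radial
       equation; positivity lets the mass be cancelled. *)
    { intros i Hi Hmi. destruct (H i Hi (- angle n i)) as [E _]. cbv zeta in E.
      rewrite Rplus_opp_r, cos_0, sin_0 in E.
      apply Rmult_eq_reg_l with (mass n (m0, m1, m2, m3) i); lra. }
    assert (Mpos : forall i, 0 < mass n (m0, m1, m2, m3) i).
    { intros i. unfold mass. destruct (Nat.eqb i 0), (Nat.leb i n), (Nat.even (i - n - 1));
        assumption. }
    assert (B1 : radius n rho 1 = rho /\ angle n 1 = 2 * PI * INR 0 / INR n).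
    { unfold radius, angle. cbn [Nat.eqb]. rewrite (proj2 (Nat.leb_le 1 n)) by lia. auto. }
    assert (B2 : radius n rho (n + 1) = 1 /\ angle n (n + 1) = 2 * PI * INR 0 / INR n).
    { unfold radius, angle. rewrite (proj2 (Nat.eqb_neq (n + 1) 0)) by lia.
      rewrite (proj2 (Nat.leb_gt (n + 1) n)) by lia.
      replace (n + 1 - n - 1)%nat with 0%nat by lia. split; [reflexivity|simpl; field; assumption]. }
    assert (B3 : radius n rho (n + 2) = 1 /\
      angle n (n + 2) = PI / INR n + 2 * PI * INR 0 / INR n).
    { unfold radius, angle. rewrite (proj2 (Nat.eqb_neq (n + 2) 0)) by lia.
      rewrite (proj2 (Nat.leb_gt (n + 2) n)) by lia.
      replace (n + 2 - n - 1)%nat with 1%nat by lia. split; [reflexivity|simpl; field; assumption]. }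
    destruct B1 as [B1 B1'], B2 as [B2 B2'], B3 as [B3 B3'].
    assert (K1 := K 1%nat ltac:(unfold Nbodies; lia) (Mpos _)).
    assert (K2 := K (n + 1)%nat ltac:(unfold Nbodies; lia) (Mpos _)).
    assert (K3 := K (n + 2)%nat ltac:(unfold Nbodies; lia) (Mpos _)).
    rewrite B1 in K1. rewrite B2 in K2. rewrite B3 in K3.
    apply (proj1 (radial_forms n rho m0 m1 m2 m3 1 0 Hn Hrho) B1) in B1'.
    apply (proj1 (proj2 (radial_forms n rho m0 m1 m2 m3 (n + 1) 0 Hn Hrho)) B2) in B2'.
    apply (proj2 (proj2 (radial_forms n rho m0 m1 m2 m3 (n + 2) 0 Hn Hrho)) B3) in B3'.
    unfold balanced. rewrite <- B1', <- B2', <- B3', K1, K2, K3. repeat split; ring.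
  - intros (E1 & E2 & E3) i Hi t u X Y.
    assert (HY : Y = 0) by (apply body_sum_tng; assumption).
    assert (HX : X = radius n rho i).
    { destruct (body_classes n rho i ltac:(lia) Hi)
        as [Hr|[[k [Hr Ha]]|[[k [Hr Ha]]|[k [Hr Ha]]]]];
        try (destruct (radial_forms n rho m0 m1 m2 m3 i k Hn Hrho) as (R1 & R2 & R3)).
      - unfold X, body_sum. rewrite Hr.
        rewrite (rsum_bodies n rho m0 m1 m2 m3 (rad 0)) by lia.
        rewrite !gon_rad_0_s by assumption. unfold rad, Rdiv. ring.
      - specialize (R1 Hr Ha). rewrite Hr. fold X in R1. rewrite E3 in R1.
        apply Rmult_eq_reg_l with (rho ^ 2); [rewrite R1; ring|].
        apply pow_nonzero. lra.
      - specialize (R2 Hr Ha). rewrite Hr. unfold X. rewrite R2. exact E1.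
      - specialize (R3 Hr Ha). rewrite Hr. unfold X. rewrite R3. exact E2. }
    rewrite HX, HY. split; ring.
Qed.

(** * The determinant of the mass equations *)

(* [-2] times the determinant of the rows [1 F0 a b], [1 F1 b a], [1 a H0 H1], [1 N N N]:
   the three balance equations and the total mass. *)
Definition mass_det (N a b F0 F1 H0 H1 : R) : R :=
  2 * (a - N) * (2 * N - a - b) * (b - a)
  + (b - a) * (H0 + H1 - 2 * N) * (F0 + F1 - 2 * N)
  + (2 * N - a - b) * (H0 - H1) * (F0 - F1).

(** Passing to [d2 + d3] and [d2 - d3] decouples the first two equations. Both combinations are then
    multiples of [d1], and the third equation becomes [d1 * mass_det = 0]. The strict sign comes
    from the first term, as [a < N]. *)
Lemma mass_kernel_trivial (N a b F0 F1 H0 H1 d0 d1 d2 d3 : R) :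
  a < b -> a + b < 2 * N ->
  (F0 + F1 - 2 * N) * (H0 + H1 - 2 * N) <= 0 -> (F0 - F1) * (H0 - H1) <= 0 ->
  d0 + d1 * F0 + d2 * a + d3 * b = 0 -> d0 + d1 * F1 + d2 * b + d3 * a = 0 ->
  d0 + d1 * a + d2 * H0 + d3 * H1 = 0 -> d0 + N * (d1 + d2 + d3) = 0 ->
  d0 = 0 /\ d1 = 0 /\ d2 = 0 /\ d3 = 0.
Proof.
  intros Hab HN Hp Hm E1 E2 E3 E4.
  assert (K1 : (F0 + F1 - 2 * N) * d1 = (2 * N - a - b) * (d2 + d3)) by lra.
  assert (K2 : (F0 - F1) * d1 = (b - a) * (d2 - d3)) by lra.
  assert (K3 : 2 * (a - N) * d1 + (H0 + H1 - 2 * N) * (d2 + d3) + (H0 - H1) * (d2 - d3) = 0)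
    by lra.
  assert (D : d1 * mass_det N a b F0 F1 H0 H1 = 0).
  { unfold mass_det.
    replace (d1 * _) with (2 * (a - N) * d1 * ((2 * N - a - b) * (b - a))
      + (b - a) * (H0 + H1 - 2 * N) * ((F0 + F1 - 2 * N) * d1)
      + (2 * N - a - b) * (H0 - H1) * ((F0 - F1) * d1)) by ring.
    rewrite K1, K2.
    replace (_ + _ + _) with ((2 * (a - N) * d1 + (H0 + H1 - 2 * N) * (d2 + d3)
      + (H0 - H1) * (d2 - d3)) * ((2 * N - a - b) * (b - a))) by ring.
    rewrite K3. ring. }
  assert (Hdet : mass_det N a b F0 F1 H0 H1 < 0).
  { unfold mass_det.
    assert (0 < (N - a) * ((2 * N - a - b) * (b - a)))
      by (repeat apply Rmult_lt_0_compat; lra).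
    assert ((b - a) * ((F0 + F1 - 2 * N) * (H0 + H1 - 2 * N)) <= 0)
      by (apply Rmult_le_0_l; lra).
    assert ((2 * N - a - b) * ((F0 - F1) * (H0 - H1)) <= 0)
      by (apply Rmult_le_0_l; lra).
    lra. }
  assert (Z1 : d1 = 0) by (destruct (Rmult_integral _ _ D); lra).
  rewrite Z1, Rmult_0_r in K1, K2.
  assert (d2 + d3 = 0) by (destruct (Rmult_integral _ _ (eq_sym K1)); lra).
  assert (d2 - d3 = 0) by (destruct (Rmult_integral _ _ (eq_sym K2)); lra).
  assert (d2 = 0) by lra. assert (d3 = 0) by lra. subst. repeat split; lra.
Qed.

Lemma mass_kernel_nontrivial (N a b F0 F1 H0 H1 : R) :
  a < b -> a + b <> 2 * N -> mass_det N a b F0 F1 H0 H1 = 0 ->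
  exists d0 d1 d2 d3, d1 <> 0 /\
  d0 + d1 * F0 + d2 * a + d3 * b = 0 /\ d0 + d1 * F1 + d2 * b + d3 * a = 0 /\
  d0 + d1 * a + d2 * H0 + d3 * H1 = 0 /\ d0 + N * (d1 + d2 + d3) = 0.
Proof.
  intros Hab HN D. unfold mass_det in D.
  set (k := 2 * N - a - b) in *.
  set (s := (F0 + F1 - 2 * N) * (b - a)). set (e := (F0 - F1) * k).
  (* The same elimination with [d1 = k (b - a)], which makes [d2 + d3 = s] and [d2 - d3 = e]; the
     vanishing determinant is the third equation. *)
  exists (- N * (k * (b - a) + s)), (k * (b - a)), ((s + e) / 2), ((s - e) / 2).
  split; [apply Rmult_integral_contrapositive; unfold k; split; lra|].
  repeat split; unfold s, e, k in *; lra.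
Qed.

Lemma small_perturbation (A B : R) : 0 < A ->
  exists e, 0 < e /\ forall x, 0 < x <= e -> 0 < A + x * B.
Proof.
  intros HA. assert (HB := Rabs_pos B). exists (A / (Rabs B + 1)). split.
  - apply Rdiv_lt_0_compat; lra.
  - intros x [Hx0 Hx].
    apply (Rmult_le_compat_r (Rabs B + 1)) in Hx; [|lra].
    unfold Rdiv in Hx. rewrite Rmult_assoc, Rinv_l in Hx by lra.
    assert (H := Rle_abs (- B)). rewrite Rabs_Ropp in H. nra.
Qed.

(* With [m1 = 0] and [m2 = m3] the equations have a solution with [m0], [m2] positive;
   it persists for small [m1]. *)
Lemma balanced_positive (a b F0 F1 H0 H1 r : R) :
  0 <= a -> a < b -> H0 + H1 <= 0 -> 0 < r < 1 ->
  exists m0 m1 m2 m3, (0 < m0 /\ 0 < m1 /\ 0 < m2 /\ 0 < m3) /\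
    m0 + m1 * F0 + m2 * a + m3 * b = 1 /\
    m0 + m1 * F1 + m2 * b + m3 * a = 1 /\
    m0 + m1 * a + m2 * H0 + m3 * H1 = r.
Proof.
  intros Ha Hab HH Hr.
  (* With [m1 = e], the first two equations force [m2 - m3 = e c]. Subtracting the third from the
     first then gives [m3 S = 1 - r - e p]. *)
  set (c := (F0 - F1) / (b - a)). set (S := a + b - H0 - H1).
  assert (HS : 0 < S) by (unfold S; lra).
  set (p := F0 - a + (a - H0) * c).
  set (x0 := (1 - r) / S). set (x1 := - p / S).
  assert (Hx0 : 0 < x0) by (apply Rdiv_lt_0_compat; lra).
  set (z0 := 1 - (a + b) * x0). set (z1 := - (a + b) * x1 - F0 - a * c).
  assert (Hz0 : 0 < z0).
  { unfold z0, x0. replace (1 - (a + b) * ((1 - r) / S)) with (((a + b) * r - (H0 + H1)) / S)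
      by (unfold S; field; fold S; lra).
    apply Rdiv_lt_0_compat; [|assumption].
    assert (0 < (a + b) * r) by (apply Rmult_lt_0_compat; lra). lra. }
  destruct (small_perturbation x0 x1 Hx0) as [e1 [He1 P1]].
  destruct (small_perturbation x0 (x1 + c) Hx0) as [e2 [He2 P2]].
  destruct (small_perturbation z0 z1 Hz0) as [e3 [He3 P3]].
  set (e := Rmin e1 (Rmin e2 e3)).
  assert (He : 0 < e) by (unfold e; repeat apply Rmin_glb_lt; assumption).
  assert (L1 : e <= e1) by apply Rmin_l.
  assert (L2 : e <= e2) by (eapply Rle_trans; [apply Rmin_r|apply Rmin_l]).
  assert (L3 : e <= e3) by (eapply Rle_trans; [apply Rmin_r|apply Rmin_r]).
  specialize (P1 e (conj He L1)). specialize (P2 e (conj He L2)). specialize (P3 e (conj He L3)).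
  exists (z0 + e * z1), e, (x0 + e * (x1 + c)), (x0 + e * x1).
  split; [auto|].
  assert (Ec : c * (b - a) = F0 - F1) by (unfold c; field; lra).
  assert (Ex0 : x0 * S = 1 - r) by (unfold x0; field; lra).
  assert (Ex1 : x1 * S = - p) by (unfold x1; field; lra).
  assert (E1 : z0 + e * z1 + e * F0 + (x0 + e * (x1 + c)) * a + (x0 + e * x1) * b = 1)
    by (unfold z0, z1; ring).
  split; [exact E1|split].
  - apply (f_equal (fun y => e * y)) in Ec. lra.
  - apply (f_equal (fun y => e * y)) in Ex1. unfold p in Ex1. unfold S in *. lra.
Qed.

Lemma really_perverse_of_det (n : nat) (rho : R) :
  (2 <= n)%nat -> 0 < rho < 1 ->
  let a := gon n (rad 1 1) 0 in let b := gon n (rad 1 1) (PI / INR n) in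
  a + b <> 2 * INR n ->
  mass_det (INR n) a b (gon n (rad 1 rho) 0) (gon n (rad 1 rho) (PI / INR n))
    (rho ^ 2 * gon n (rad rho 1) 0) (rho ^ 2 * gon n (rad rho 1) (PI / INR n)) = 0 ->
  really_perverse n rho.
Proof.
  intros Hn Hrho a b HN Hdet.
  destruct (gon_rad_unit_lt n ltac:(lia)) as [Ha Hab]. fold a b in Ha, Hab.
  destruct (gon_rad_inside rho Hrho n ltac:(lia)) as (_ & _ & _ & HG).
  destruct (mass_kernel_nontrivial _ _ _ _ _ _ _ Hab HN Hdet)
    as (d0 & d1 & d2 & d3 & Hd & K1 & K2 & K3 & K4).
  assert (Hr : 0 < rho ^ 3 < 1).
  { split; [apply pow_lt; lra|]. simpl. assert (rho * rho < 1) by nra. nra. }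
  assert (HH : rho ^ 2 * gon n (rad rho 1) 0 + rho ^ 2 * gon n (rad rho 1) (PI / INR n) <= 0).
  { rewrite <- Rmult_plus_distr_l. apply Rmult_le_0_l; [apply pow2_ge_0|assumption]. }
  destruct (balanced_positive a b (gon n (rad 1 rho) 0) (gon n (rad 1 rho) (PI / INR n)) _ _ _
    Ha Hab HH Hr) as (m0 & m1 & m2 & m3 & (P0 & P1 & P2 & P3) & E1 & E2 & E3).
  destruct (small_perturbation m0 d0 P0) as [e0 [He0 Q0]].
  destruct (small_perturbation m1 d1 P1) as [e1 [He1 Q1]].
  destruct (small_perturbation m2 d2 P2) as [e2 [He2 Q2]].
  destruct (small_perturbation m3 d3 P3) as [e3 [He3 Q3]].
  set (e := Rmin (Rmin e0 e1) (Rmin e2 e3)).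
  assert (He : 0 < e) by (unfold e; repeat apply Rmin_glb_lt; assumption).
  specialize (Q0 e (conj He (Rle_trans _ _ _ (Rmin_l _ _) (Rmin_l _ _)))).
  specialize (Q1 e (conj He (Rle_trans _ _ _ (Rmin_l _ _) (Rmin_r _ _)))).
  specialize (Q2 e (conj He (Rle_trans _ _ _ (Rmin_r _ _) (Rmin_l _ _)))).
  specialize (Q3 e (conj He (Rle_trans _ _ _ (Rmin_r _ _) (Rmin_r _ _)))).
  exists (m0, m1, m2, m3), (m0 + e * d0, m1 + e * d1, m2 + e * d2, m3 + e * d3).
  assert (Pm : mass_positive (m0, m1, m2, m3)) by (repeat split; assumption).
  assert (Pm' : mass_positive (m0 + e * d0, m1 + e * d1, m2 + e * d2, m3 + e * d3))
    by (repeat split; assumption).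
  split; [exact Pm|split; [exact Pm'|split; [|split; [|split]]]].
  - intros E. injection E. intros _ _ E' _.
    assert (Z : e * d1 = 0) by lra. destruct (Rmult_integral _ _ Z); lra.
  - unfold total_mass. apply (f_equal (fun y => e * y)) in K4. lra.
  - apply RE_solution_balanced; [assumption|lra|assumption|].
    unfold balanced. fold a b. auto.
  - apply RE_solution_balanced; [assumption|lra|assumption|].
    unfold balanced. fold a b.
    apply (f_equal (fun y => e * y)) in K1, K2, K3. repeat split; lra.
Qed.

(** * Nonexistence below the threshold *)

Lemma not_really_perverse (n : nat) (rho : R) :
  (2 <= n <= 236)%nat -> admissible rho -> ~ really_perverse n rho.
Proof.
  intros Hn [Hrho Hrho1] (m & m' & Pm & Pm' & Hneq & HM & S & S').
  apply RE_solution_balanced in S, S'; try assumption; try lia.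
  destruct m as [[[m0 m1] m2] m3], m' as [[[m0' m1'] m2'] m3'].
  destruct S as (E1 & E2 & E3), S' as (E1' & E2' & E3'). unfold total_mass in HM.
  destruct (gon_rad_unit_lt n ltac:(lia)) as [Ha Hab].
  assert (HN := gon_rad_unit_sum n ltac:(lia)).
  assert (Hc := csc_sum_small (2 * n) ltac:(lia)).
  assert (H2n : INR (2 * n) = 2 * INR n) by (rewrite mult_INR; reflexivity).
  assert (Hsign : let F0 := gon n (rad 1 rho) 0 in
    let F1 := gon n (rad 1 rho) (PI / INR n) in
    let H0 := rho ^ 2 * gon n (rad rho 1) 0 in
    let H1 := rho ^ 2 * gon n (rad rho 1) (PI / INR n) in
    (F0 + F1 - 2 * INR n) * (H0 + H1 - 2 * INR n) <= 0 /\ (F0 - F1) * (H0 - H1) <= 0).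
  { assert (N0 : 0 <= INR n) by apply pos_INR.
    destruct (Rtotal_order rho 1) as [Hlt|[Heq|Hgt]]; [|contradiction|]; cbv zeta.
    - destruct (gon_rad_inside rho (conj Hrho Hlt) n ltac:(lia)) as (A1 & A2 & A3 & A4).
      assert (0 < rho ^ 2) by (apply pow_lt; lra).
      rewrite <- Rmult_plus_distr_l, <- Rmult_minus_distr_l. split.
      + apply Rmult_le_0_l; [lra|].
        assert (rho ^ 2 * (gon n (rad rho 1) 0 + gon n (rad rho 1) (PI / INR n)) <= 0)
          by (apply Rmult_le_0_l; lra). lra.
      + apply Rmult_le_0_l; [lra|]. apply Rmult_le_0_l; lra.
    (* Outside the unit circle the two factors of each product change places, which leaves the signs
       of the products alone. *)
    - set (s := / rho).
      assert (Hs : 0 < s < 1).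
      { unfold s. split; [apply Rinv_0_lt_compat; lra|].
        rewrite <- Rinv_1. apply Rinv_lt_contravar; lra. }
      destruct (gon_rad_inside s Hs n ltac:(lia)) as (A1 & A2 & A3 & A4).
      destruct (gon_rad_dual n rho 0 Hrho) as [-> ->].
      destruct (gon_rad_dual n rho (PI / INR n) Hrho) as [-> ->]. fold s.
      assert (0 < s ^ 2) by (apply pow_lt; lra).
      rewrite <- Rmult_plus_distr_l, <- Rmult_minus_distr_l. split.
      + rewrite Rmult_comm. apply Rmult_le_0_l; [lra|].
        assert (s ^ 2 * (gon n (rad s 1) 0 + gon n (rad s 1) (PI / INR n)) <= 0)
          by (apply Rmult_le_0_l; lra). lra.
      + rewrite Rmult_comm. apply Rmult_le_0_l; [lra|]. apply Rmult_le_0_l; lra. }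
  destruct Hsign as [Hp Hm].
  destruct (mass_kernel_trivial (INR n) _ _ _ _ _ _
    (m0 - m0') (m1 - m1') (m2 - m2') (m3 - m3') Hab ltac:(lra) Hp Hm
    ltac:(lra) ltac:(lra) ltac:(lra) ltac:(lra)) as (Z0 & Z1 & Z2 & Z3).
  apply Hneq. repeat f_equal; lra.
Qed.

(** * Existence by a sign change in the radius *)

Lemma cos_lt_1 (x : R) : 0 < x < 2 * PI -> cos x < 1.
Proof.
  intros Hx. replace x with (2 * (x / 2)) by field. rewrite cos_2a_sin.
  assert (0 < sin (x / 2)) by (apply sin_gt_0; lra). nra.
Qed.

(** The squared distance is [(1 - y) ^ 2 + 2 y (1 - cos x)], positive even at [y = 1]: only a vertex
    at angle [0] can collide. *)
Lemma continuity_pt_rad (x y : R) : 0 <= y -> cos x < 1 ->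
  continuity_pt (fun r => rad 1 r x) y /\ continuity_pt (fun r => rad r 1 x) y.
Proof.
  intros Hy Hx. assert (D : 0 < 1 + y ^ 2 - 2 * y * cos x).
  { destruct Hy as [Hy|<-]; [|lra].
    assert (0 < y * (1 - cos x)) by (apply Rmult_lt_0_compat; lra).
    assert (0 <= (1 - y) ^ 2) by apply pow2_ge_0. lra. }
  split; apply derivable_continuous_pt, ex_derive_Reals_0; unfold rad; auto_derive.
  - assert (D' : 0 < 1 * (1 * 1) + y * (y * 1) + - (2 * 1 * y * cos x)) by lra.
    assert (S0 := sqrt_lt_R0 _ D'). repeat split; [assumption|].
    apply Rgt_not_eq. repeat apply Rmult_lt_0_compat; lra.
  - assert (D' : 0 < y * (y * 1) + 1 * (1 * 1) + - (2 * y * 1 * cos x)) by lra.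
    assert (S0 := sqrt_lt_R0 _ D'). repeat split; [assumption|].
    apply Rgt_not_eq. repeat apply Rmult_lt_0_compat; lra.
Qed.

(* The attraction of an [n]-gon without its vertex at angle [0]. *)
Definition gon_tail (n : nat) (f : R -> R) : R :=
  rsum (fun l => f (2 * PI * INR (S l) / INR n)) (n - 1).

Lemma gon_head (n : nat) (f : R -> R) : (1 <= n)%nat -> gon n f 0 = f 0 + gon_tail n f.
Proof.
  intros Hn. assert (Hn0 : INR n <> 0) by (apply not_0_INR; lia).
  unfold gon, gon_tail. destruct n as [|m]; [lia|].
  replace (S m - 1)%nat with m by lia. rewrite rsum_head. f_equal.
  - f_equal. simpl (INR 0). field. assumption.
  - apply rsum_ext. intros l _. f_equal. ring.
Qed.

Lemma cos_vertex_lt_1 (n l : nat) : (1 <= n)%nat ->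
  ((l < n - 1)%nat -> cos (2 * PI * INR (S l) / INR n) < 1) /\
  ((l < n)%nat -> cos (PI / INR n + 2 * PI * INR l / INR n) < 1).
Proof.
  intros Hn. assert (Hn0 : INR n <> 0) by (apply not_0_INR; lia).
  split; intros Hl; apply cos_lt_1.
  - assert (H := arc_bounds n (S l) ltac:(lia)).
    replace (2 * PI * INR (S l) / INR n) with (2 * (PI * INR (S l) / INR n))
      by (field; assumption). lra.
  - assert (H := arc_bounds (2 * n) (2 * l + 1) ltac:(lia)).
    replace (PI / INR n + 2 * PI * INR l / INR n)
      with (2 * (PI * INR (2 * l + 1) / INR (2 * n))); [lra|].
    rewrite plus_INR, !mult_INR. simpl. field. assumption.
Qed.

(* [(1 - rho)^4] times the determinant, with the poles at [rho = 1] cleared. *)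
Definition cleared_det (n : nat) (rho : R) : R :=
  let N := INR n in
  let a := gon n (rad 1 1) 0 in let b := gon n (rad 1 1) (PI / N) in
  let w := (1 - rho) ^ 2 in
  let f0 := 1 + w * gon_tail n (rad 1 rho) in
  let f1 := w * gon n (rad 1 rho) (PI / N) in
  let h0 := rho ^ 2 * (- 1 + w * gon_tail n (rad rho 1)) in
  let h1 := rho ^ 2 * (w * gon n (rad rho 1) (PI / N)) in
  2 * (a - N) * (2 * N - a - b) * (b - a) * w ^ 2
  + (b - a) * (h0 + h1 - 2 * N * w) * (f0 + f1 - 2 * N * w)
  + (2 * N - a - b) * (h0 - h1) * (f0 - f1).

Lemma cleared_det_spec (n : nat) (rho : R) : (1 <= n)%nat -> 0 < rho < 1 ->
  cleared_det n rho = (1 - rho) ^ 4 *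
  mass_det (INR n) (gon n (rad 1 1) 0) (gon n (rad 1 1) (PI / INR n))
    (gon n (rad 1 rho) 0) (gon n (rad 1 rho) (PI / INR n))
    (rho ^ 2 * gon n (rad rho 1) 0) (rho ^ 2 * gon n (rad rho 1) (PI / INR n)).
Proof.
  intros Hn Hrho. unfold cleared_det, mass_det.
  rewrite (gon_head n (rad 1 rho)), (gon_head n (rad rho 1)) by assumption.
  assert (E1 : rad 1 rho 0 = / (1 - rho) ^ 2).
  { unfold rad. rewrite cos_0.
    replace (1 ^ 2 + rho ^ 2 - 2 * 1 * rho * 1) with ((1 - rho) ^ 2) by ring.
    rewrite sqrt_pow2 by lra. field. lra. }
  assert (E2 : rad rho 1 0 = - / (1 - rho) ^ 2).
  { unfold rad. rewrite cos_0.
    replace (rho ^ 2 + 1 ^ 2 - 2 * rho * 1 * 1) with ((1 - rho) ^ 2) by ring.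
    rewrite sqrt_pow2 by lra. field. lra. }
  rewrite E1, E2. field. lra.
Qed.

Lemma continuity_pt_fun_mult (f g : R -> R) (x : R) :
  continuity_pt f x -> continuity_pt g x -> continuity_pt (fun y => f y * g y) x.
Proof. apply (continuity_pt_mult f g). Qed.

Lemma continuity_pt_fun_plus (f g : R -> R) (x : R) :
  continuity_pt f x -> continuity_pt g x -> continuity_pt (fun y => f y + g y) x.
Proof. apply (continuity_pt_plus f g). Qed.

Lemma continuity_pt_fun_minus (f g : R -> R) (x : R) :
  continuity_pt f x -> continuity_pt g x -> continuity_pt (fun y => f y - g y) x.
Proof. apply (continuity_pt_minus f g). Qed.

Lemma continuity_pt_cst (c x : R) : continuity_pt (fun _ => c) x.
Proof. apply continuity_pt_const. intros ? ?; reflexivity. Qed.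

Lemma continuity_pt_cleared_det (n : nat) (rho : R) : (1 <= n)%nat -> 0 <= rho ->
  continuity_pt (cleared_det n) rho.
Proof.
  intros Hn Hrho.
  assert (C1 : continuity_pt (fun r => gon_tail n (rad 1 r)) rho).
  { apply (continuity_pt_rsum (fun l r => rad 1 r (2 * PI * INR (S l) / INR n))).
    intros l Hl. apply continuity_pt_rad; [assumption|]. apply cos_vertex_lt_1; assumption. }
  assert (C2 : continuity_pt (fun r => gon_tail n (rad r 1)) rho).
  { apply (continuity_pt_rsum (fun l r => rad r 1 (2 * PI * INR (S l) / INR n))).
    intros l Hl. apply continuity_pt_rad; [assumption|]. apply cos_vertex_lt_1; assumption. }
  assert (C3 : continuity_pt (fun r => gon n (rad 1 r) (PI / INR n)) rho).
  { apply (continuity_pt_rsum (fun l r => rad 1 r (PI / INR n + 2 * PI * INR l / INR n))).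
    intros l Hl. apply continuity_pt_rad; [assumption|]. apply cos_vertex_lt_1; assumption. }
  assert (C4 : continuity_pt (fun r => gon n (rad r 1) (PI / INR n)) rho).
  { apply (continuity_pt_rsum (fun l r => rad r 1 (PI / INR n + 2 * PI * INR l / INR n))).
    intros l Hl. apply continuity_pt_rad; [assumption|]. apply cos_vertex_lt_1; assumption. }
  assert (C5 : continuity_pt (fun r => r) rho) by apply derivable_continuous_pt, derivable_pt_id.
  unfold cleared_det. cbv zeta. simpl pow.
  repeat first [ assumption | apply continuity_pt_cst | apply continuity_pt_fun_minus
    | apply continuity_pt_fun_plus | apply continuity_pt_fun_mult ].
Qed.

(** At [rho = 0] the inner ring acts as a mass [n] at the center, so both factors in [F0] and [F1]
    vanish. At [rho = 1] only the poles of the colliding vertices remain. *)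
Lemma cleared_det_endpoints (n : nat) : (1 <= n)%nat ->
  let N := INR n in
  let a := gon n (rad 1 1) 0 in let b := gon n (rad 1 1) (PI / N) in
  cleared_det n 0 = 2 * (a - N) * (2 * N - a - b) * (b - a) /\
  cleared_det n 1 = 2 * (a - N).
Proof.
  intros Hn N a b. unfold cleared_det. fold N. fold a b. split; [|ring].
  assert (E1 : gon_tail n (rad 1 0) = N - 1).
  { unfold gon_tail. rewrite (rsum_ext _ (fun _ => 1)).
    - rewrite rsum_const, minus_INR by assumption. unfold N. simpl. ring.
    - intros k _. rewrite rad_r_0 by lra. field. }
  assert (E2 : gon n (rad 1 0) (PI / N) = N).
  { unfold gon. rewrite (rsum_ext _ (fun _ => 1)).
    - rewrite rsum_const. unfold N. ring.
    - intros k _. rewrite rad_r_0 by lra. field. }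
  rewrite E1, E2. ring.
Qed.

Lemma sign_change_root (f : R -> R) : (forall x, 0 <= x -> continuity_pt f x) ->
  f 0 * f 1 < 0 -> exists x, 0 < x < 1 /\ f x = 0.
Proof.
  intros Hc Hf.
  assert (H : exists x, 0 <= x <= 1 /\ f x = 0).
  { destruct (Rtotal_order (f 0) 0) as [H0|[H0|H0]]; [|rewrite H0 in Hf; lra|].
    - destruct (IVT_interv f 0 1) as [x [Hx E]]; try lra; [|nra|eauto].
      intros x Hx. apply Hc. lra.
    - destruct (IVT_interv (fun x => - f x) 0 1) as [x [Hx E]]; try lra; [|nra|].
      + intros x Hx. apply (continuity_pt_opp f). apply Hc. lra.
      + exists x. split; [assumption|lra]. }
  destruct H as [x [Hx E]]. exists x. split; [|exact E].
  assert (x <> 0) by (intros ->; rewrite E in Hf; lra).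
  assert (x <> 1) by (intros ->; rewrite E in Hf; lra). lra.
Qed.

Lemma exists_really_perverse (n : nat) : (237 <= n)%nat ->
  exists rho, admissible rho /\ really_perverse n rho.
Proof.
  intros Hn.
  set (N := INR n). set (a := gon n (rad 1 1) 0). set (b := gon n (rad 1 1) (PI / N)).
  destruct (gon_rad_unit_lt n ltac:(lia)) as [Ha Hab]. fold N in Hab. fold a b in Ha, Hab.
  assert (Hsum : 2 * N < a + b).
  { assert (H := csc_sum_large (2 * n) ltac:(lia)).
    assert (H' := gon_rad_unit_sum n ltac:(lia)). fold N in H'. fold a b in H'.
    rewrite mult_INR in H. fold N in H. simpl (INR 2) in H. lra. }
  (* [a] lies below [N] up to [n = 472] and above it afterwards; either sign will do, since the
     product of the endpoint values contains [(a - N) ^ 2]. *)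
  assert (HaN : a <> N).
  { assert (E := gon_rad_unit_csc n ltac:(lia)). fold a in E.
    destruct (Nat.le_gt_cases n 472) as [H|H].
    - assert (H' := csc_sum_small n ltac:(lia)). fold N in H'. lra.
    - assert (H' := csc_sum_large n ltac:(lia)). fold N in H'. lra. }
  destruct (cleared_det_endpoints n ltac:(lia)) as [D0 D1].
  fold N in D0, D1. fold a b in D0, D1.
  destruct (sign_change_root (cleared_det n)) as [rho [Hrho E]].
  - intros x Hx. apply continuity_pt_cleared_det; [lia|assumption].
  - rewrite D0, D1.
    assert (0 < (a - N) ^ 2 * ((a + b - 2 * N) * (b - a))).
    { apply Rmult_lt_0_compat; [apply pow2_gt_0; lra|apply Rmult_lt_0_compat; lra]. }
    lra.
  - exists rho. split; [split; lra|].
    apply really_perverse_of_det; [lia|assumption|fold N; fold a b; lra|].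
    rewrite cleared_det_spec in E by (try lia; assumption).
    destruct (Rmult_integral _ _ E) as [Z|Z]; [|exact Z].
    exfalso. revert Z. apply pow_nonzero. lra.
Qed.

Theorem theorem1 : forall n : nat, (2 <= n)%nat ->
  ((237 <= n)%nat -> exists rho : R, admissible rho /\ really_perverse n rho) /\
  ((n <= 236)%nat -> forall rho : R, admissible rho -> ~ really_perverse n rho).
Proof.
  intros n Hn. split.
  - apply exists_really_perverse.
  - intros Hn' rho. apply not_really_perverse. lia.
Qed.
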